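(* For every fixed $\delta$ with $0<\delta<1$ and all real numbers $N,y$ with $1\le y\le\sqrt N$, $$\sum_{k\le N}(N-k)^2\,\widetilde{\mathfrak S}_y(k)^2=\mathcal T(y)\,\frac{N^3}{3}\left(1+O_\delta\!\left(\Big(\frac{y^2}{N}\Big)^{\delta}\right)\right),$$ where $\mathcal T(y)=\sum_{q>y}\frac{\mu(q)^2}{\phi(q)^3}$, and the implied constant depends only on $\delta$.
   Context: Sums over $k$ and $q$ run over positive integers; in particular $\sum_{k\le N}$ means $\sum_{1\le k\le N}$. $\mu$ is the Möbius function and $\phi$ is Euler's totient function. The Ramanujan sum is $c_q(n)=\sum_{1\le a\le q,\ (a,q)=1}e^{2\pi i an/q}$. For a positive integer $k$ and real $y\ge1$, the tail of the singular series is $$\widetilde{\mathfrak S}_y(k)=\sum_{q>y}\frac{\mu(q)^2}{\phi(q)^2}\,c_q(-k).$$ *)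

(* Defs.v *)
From mathcomp Require Import all_boot all_order all_algebra.
From mathcomp Require Import all_classical all_reals all_analysis.
From mathcomp Require Export complex.

Set Implicit Arguments.
Unset Strict Implicit.
Unset Printing Implicit Defensive.

Import Order.TTheory GRing.Theory Num.Theory.
Import numFieldNormedType.Exports.

Local Open Scope ring_scope.

(** [mobius 0] is irrelevant and set to 0. *)
Definition mobius (n : nat) : int :=
  if (0 < n)%N && all (fun p => logn p n == 1%N) (primes n)
  then (- 1) ^+ size (primes n) else 0.

(** [expi t] is e^(it), written through Euler's formula. *)
Definition expi (R : realType) (t : R) : R[i] := Complex (cos t) (sin t).

Definition ramanujan_sum (R : realType) (q : nat) (n : int) : R[i] :=
  \sum_(1 <= a < q.+1 | coprime a q) expi (2 * pi * a%:R * n%:~R / q%:R).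

(** Limit of the partial sums over 1 <= q < n with [P q], for the topology given
    by the norm of K; used below with K = R and K = R[i]. *)
Definition pos_series (K : numFieldType) (P : pred nat) (u : nat -> K) : K :=
  \big[+%R/0]_(1 <= q <oo | P q) u q.

(** Absolutely convergent for k > 0, since then |c_q(-k)| <= k for all q. *)
Definition singular_tail (R : realType) (y : R) (k : nat) : R[i] :=
  @pos_series R[i] (fun q => y < q%:R)
    (fun q => (mobius q)%:~R ^+ 2 / (totient q)%:R ^+ 2 *
              ramanujan_sum R q (- k%:Z)).

Definition singular_tail_mean (R : realType) (y : R) : R :=
  pos_series (fun q => y < q%:R)
    (fun q => (mobius q)%:~R ^+ 2 / (totient q)%:R ^+ 3).

(* Main.v *)
(* For squarefree q, c_q(-k) = sum_(d | q, d | k) mu(q/d) d.  Hence, truncating the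
   series at q < M and writing m for the integer part of y, the tail is a divisor
   sum S(k) = sum_(d | k) d a(d), with a(d) = sum_(m < q < M, d | q) mu(q/d) / phi(q)^2
   over squarefree q.  Expanding the square and summing (N - k)^2 over the multiples k
   of D = lcm(d, d') gives N^3 / (3 D) with an error at most N^2 (N / D)^s for every s
   in [0, 1].
   The main terms add up to (N^3 / 3) sum_(d, d') a(d) a(d') gcd(d, d'), which
   gcd = sum phi diagonalises: sum_(e | d) a(d) = [m < e] mu(e)^2 / phi(e)^2, so the form
   is the truncation of T(y).  For the errors take s = 1 - delta.  On average q / phi(q)
   is bounded, so |d a(d)| behaves like 1 / (d + m), and the errors sum to
   O(N^(2 + s) m^(-2 s)).  As T(y) >> m^(-2), this is the claim; all bounds are uniform
   in M, which then tends to infinity. *)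
Require Import Defs.
From mathcomp Require Import all_boot all_order all_algebra.
From mathcomp Require Import all_classical all_reals all_analysis.
From mathcomp Require Import cyclic zify ring lra.
Import Order.TTheory GRing.Theory Num.Theory.
Import numFieldNormedType.Exports.
Local Open Scope ring_scope.
Local Open Scope complex_scope.

(** * Divisor sums and the Moebius function *)

Section Divisors.
Variable V : nmodType.
Implicit Types (F : nat -> V) (e n m M d : nat).

Lemma sum_multiples e M F : (0 < e)%N ->
  \sum_(1 <= d < M | (e %| d)%N) F d
  = \sum_(1 <= j < M | (e * j < M)%N) F (e * j)%N.
Proof.
move=> e0; symmetry.
transitivity (\sum_(1 <= j < M) \sum_(1 <= d < M | d == (e * j)%N) F d).
  rewrite big_nat_cond big_mkcond [RHS]big_nat; rewrite [LHS]big_nat.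
  apply: eq_bigr => j jM; rewrite big_nat1_eq jM /=.
  by rewrite muln_gt0 e0; case/andP: jM => -> .
rewrite [RHS]big_mkcond (exchange_big_dep_nat xpredT) //=.
rewrite !big_nat; apply: eq_bigr => d /andP[d1 dM].
case: ifPn => [/dvdnP[c dE]|ned].
  rewrite (eq_bigl (fun j => j == c)) => [|j]; last first.
    by rewrite dE mulnC eqn_pmul2l// eq_sym.
  have c0 : (0 < c)%N by move: d1; rewrite dE muln_gt0 => /andP[].
  rewrite big_nat1_eq c0 /=.
  by rewrite (leq_ltn_trans _ dM)// dE leq_pmulr.
apply: big1 => j /eqP dE; move: ned; by rewrite dE dvdn_mulr.
Qed.

Lemma sum_divisors_range n M F : (0 < n < M)%N ->
  \sum_(1 <= d < M | (d %| n)%N) F d = \sum_(1 <= d < n.+1 | (d %| n)%N) F d.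
Proof.
move=> /andP[n0 nM]; rewrite [RHS](big_nat_widen _ _ M)//.
rewrite [LHS]big_nat_cond [RHS]big_nat_cond; apply: eq_bigl => d.
by case dn: (d %| n)%N; rewrite ?andbF//= ltnS (dvdn_leq n0 dn).
Qed.

(** Both sides count the pairs (d, c) with d c = n, weighted by [F c]; since n < M, the cofactor of
    a divisor stays in the range. *)
Lemma sum_divisors_flip n M F : (0 < n < M)%N ->
  \sum_(1 <= d < M | (d %| n)%N) F (n %/ d)%N
  = \sum_(1 <= d < M | (d %| n)%N) F d.
Proof.
move=> /andP[n0 nM].
have H c : (0 < c < M)%N -> \sum_(1 <= d < M | (d * c)%N == n) F c
   = if (c %| n)%N then F c else 0.
  move=> /andP[c0 cM]; case: ifPn => [/dvdnP[b nE]|ncn].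
    rewrite (eq_bigl (fun j => j == b)) => [|j]; last by rewrite nE eqn_pmul2r.
    rewrite big_nat1_eq.
    have b0 : (0 < b)%N by move: n0; rewrite nE muln_gt0 => /andP[].
    by rewrite b0 (leq_ltn_trans _ nM)// nE leq_pmulr.
  by apply: big1 => j /eqP nE; move: ncn; rewrite -nE dvdn_mull.
rewrite [RHS]big_mkcond /=.
transitivity (\sum_(1 <= c < M) \sum_(1 <= d < M | (d * c)%N == n) F c).
  rewrite (exchange_big_dep_nat xpredT) //= big_mkcond /= !big_nat.
  apply: eq_bigr => d /andP[d0 dM]; case: ifPn => [/dvdnP[c nE]|ndn].
    rewrite nE mulnK// (eq_bigl (fun j => j == c)) => [|j]; last first.
      by rewrite mulnC eqn_pmul2r.
    have c0 : (0 < c)%N by move: n0; rewrite nE muln_gt0 => /andP[].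
    by rewrite big_nat1_eq c0 (leq_ltn_trans _ nM)// nE leq_pmulr.
  by rewrite big1// => c /eqP nE; move: ndn; rewrite -nE dvdn_mulr.
by rewrite !big_nat; apply: eq_bigr => c; exact: H.
Qed.

(** A divisor of p m prime to p divides m by Gauss's lemma; the other divisors are p d with d
    dividing m. *)
Lemma sum_divisors_prime p m M F : prime p -> ~~ (p %| m)%N -> (0 < m)%N ->
    (p * m < M)%N ->
  \sum_(1 <= d < M | (d %| p * m)%N) F d
  = \sum_(1 <= d < M | (d %| m)%N) F d + \sum_(1 <= d < M | (d %| m)%N) F (p * d)%N.
Proof.
move=> pp pm m0 pmM; have p0 := prime_gt0 pp.
rewrite (bigID (fun d => p %| d)%N) /= addrC; congr (_ + _).
  apply: eq_bigl => d; apply/andP/idP => [[dpm pd]|dm].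
    by move: dpm; rewrite Gauss_dvdr// coprime_sym prime_coprime.
  split; first exact: dvdn_mull.
  by apply: contra pm => /dvdn_trans; apply.
transitivity (\sum_(1 <= d < M | (p %| d)%N) (if (d %| p * m)%N then F d else 0)).
  by rewrite big_mkcondl.
rewrite sum_multiples// big_mkcond [RHS]big_mkcond /= !big_nat; apply: eq_bigr => j _.
rewrite dvdn_pmul2l//; case: ifPn => // pjM; case: ifP => // jm.
by move: pjM; rewrite (leq_ltn_trans _ pmM)// leq_pmul2l// dvdn_leq.
Qed.

End Divisors.

(** * Squarefree integers and the Möbius function on them *)

Definition squarefree (n : nat) : bool :=
  (0 < n)%N && all (fun p => logn p n == 1%N) (primes n).

Lemma mobius_sqr n : mobius n ^+ 2 = (squarefree n)%:R.
Proof. by rewrite /mobius -/(squarefree n); case: ifP; rewrite ?expr0n// sqrr_sign. Qed.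

Lemma squarefreeP n :
  reflect ((0 < n)%N /\ forall p, prime p -> ~~ (p ^ 2 %| n)%N) (squarefree n).
Proof.
apply: (iffP andP) => -[n0 H]; split => //.
  move=> p pp; rewrite pfactor_dvdn// -ltnNge ltnS.
  have [pn|] := boolP (p \in primes n); first by rewrite (eqP (allP H p pn)).
  by rewrite -logn_gt0 -leqNgt leqn0 => /eqP ->.
apply/allP => p pn; have pp : prime p by move: pn; rewrite mem_primes => /andP[].
by move: (H p pp) pn; rewrite pfactor_dvdn// -logn_gt0; lia.
Qed.

Lemma squarefree_gt0 n : squarefree n -> (0 < n)%N.
Proof. by case/andP. Qed.

Lemma squarefree_dvd d n : (d %| n)%N -> squarefree n -> squarefree d.
Proof.
move=> dn /squarefreeP[n0 H]; apply/squarefreeP; split; first exact: dvdn_gt0 dn.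
by move=> p pp; apply: contra (H p pp) => /dvdn_trans; apply.
Qed.

Lemma squarefree_coprime d e : squarefree (d * e) -> coprime d e.
Proof.
move=> /squarefreeP[]; rewrite muln_gt0 => /andP[d0 e0] H.
rewrite /coprime eqn_leq gcdn_gt0 d0 andbT leqNgt; apply/negP => g1.
have /negP := H _ (pdiv_prime g1); apply; rewrite expnS expn1; apply: dvdn_mul.
  exact: dvdn_trans (pdiv_dvd _) (dvdn_gcdl _ _).
exact: dvdn_trans (pdiv_dvd _) (dvdn_gcdr _ _).
Qed.

(** Strong induction that peels off the smallest prime factor; squarefreeness makes it coprime to
    the cofactor. *)
Lemma squarefree_ind (P : nat -> Prop) : P 1%N ->
  (forall p m, prime p -> ~~ (p %| m)%N -> squarefree (p * m) -> P m -> P (p * m)%N) ->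
  forall n, squarefree n -> P n.
Proof.
move=> P1 Pp n; elim/ltn_ind: n => n IH sn; have n0 := squarefree_gt0 _ sn.
case: (ltngtP n 1) => [|n1|->//]; first by rewrite ltnS leqn0; case: n n0 {IH sn}.
have pp := pdiv_prime n1; have /dvdnP[m nE] := pdiv_dvd n.
rewrite mulnC in nE; move: (pdiv n) pp nE => p pp nE; rewrite nE in n0 sn IH *.
have m0 : (0 < m)%N by move: n0; rewrite muln_gt0 => /andP[].
apply: Pp => //; first by rewrite -prime_coprime// squarefree_coprime.
apply: IH; first by rewrite ltn_Pmull// prime_gt1.
exact: squarefree_dvd (dvdn_mull _ _) sn.
Qed.

Lemma mobius_prime_mul p m : prime p -> ~~ (p %| m)%N -> squarefree (p * m) ->
  mobius (p * m) = - mobius m.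
Proof.
move=> pp pm spm; have sm : squarefree m by apply: squarefree_dvd spm; exact: dvdn_mull.
rewrite /mobius -!/(squarefree _) spm sm.
suff /perm_size -> : perm_eq (primes (p * m)) (p :: primes m) by rewrite /= exprS mulN1r.
apply: uniq_perm => [||q]; rewrite ?primes_uniq//=.
  by rewrite primes_uniq mem_primes (negPf pm) !andbF.
by rewrite primesM ?(prime_gt0 pp) ?(squarefree_gt0 _ sm)// primes_prime// !inE.
Qed.

(** For a prime p dividing n, the divisors d and p d of n, with d prime to p, carry opposite signs
    and cancel. *)
Lemma sum_mobius n M : squarefree n -> (n < M)%N ->
  \sum_(1 <= d < M | (d %| n)%N) mobius d = (n == 1%N)%:R.
Proof.
case: (boolP (n == 1%N)) => [/eqP -> _ M1|n1 sn].
  rewrite (eq_bigl (fun d => d == 1%N)) => [|d]; last by rewrite dvdn1.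
  by rewrite big_nat1_eq M1.
move: n1; elim/squarefree_ind: n / sn => [//|p m pp pm spm _ _ pmM].
rewrite sum_divisors_prime// ?(@squarefree_gt0 m)//; last first.
  exact: squarefree_dvd (dvdn_mull _ _) spm.
rewrite -big_split big1_seq//= => d /andP[dm _].
rewrite mobius_prime_mul ?subrr//; first by apply: contra pm => /dvdn_trans; apply.
by apply: squarefree_dvd spm; rewrite dvdn_pmul2l// prime_gt0.
Qed.

(** * Ramanujan sums *)

Section RamanujanSum.
Variable R : realType.

Lemma expiD (s t : R) : expi (s + t) = expi s * expi t.
Proof. by rewrite /expi cosD sinD; simpc; congr (_ +i* _); rewrite addrC. Qed.

Lemma expiMn (t : R) n : expi (t *+ n) = expi t ^+ n.
Proof.
elim: n => [|n IH]; first by rewrite mulr0n /expi cos0 sin0 expr0.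
by rewrite mulrS expiD IH exprS.
Qed.

Lemma expi_eq1 (t : R) : 0 < t < 2 * pi -> expi t != 1.
Proof.
move=> /andP[t0 t2]; apply/eqP => -[c1 _].
have s0 : 0 < sin (t / 2) by apply: sin_gt0_pi; apply/andP; split; lra.
have := cos_mulr2n (t / 2); have -> : t / 2 *+ 2 = t by rewrite -mulr_natr; field.
rewrite c1 cos2sin2 => E.
have : sin (t / 2) ^+ 2 = 0 by lra.
by move/eqP; rewrite expf_eq0/= gt_eqF.
Qed.

(** Orthogonality of additive characters modulo c: a geometric sum of a c-th root of unity that
    equals 1 exactly when c divides k. The guard [j <= c] matches the index set produced by
    [sum_multiples]. *)
Lemma sum_expi c k M : (0 < c < M)%N ->
  \sum_(1 <= j < M | (j <= c)%N) expi (- (2 * pi * k%:R * j%:R / c%:R : R))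
  = if (c %| k)%N then c%:R else 0.
Proof.
move=> /andP[c0 cM].
pose z := expi (- (2 * pi * k%:R / c%:R) : R).
have cN0 : c%:R != 0 :> R by rewrite pnatr_eq0 -lt0n.
have expi1 : expi (2 * pi : R) = 1.
  by rewrite mulr_natl /expi cos2pi mulr2n sinD sinpi mul0r mulr0 addr0.
have zj j : expi (- (2 * pi * k%:R * j%:R / c%:R) : R) = z ^+ j.
  by rewrite -expiMn; congr expi; rewrite -mulr_natr; field.
rewrite (eq_bigr (fun j => z ^+ j)) => [|j _]; last exact: zj.
have -> : \sum_(1 <= j < M | (j <= c)%N) z ^+ j = \sum_(1 <= j < c.+1) z ^+ j.
  rewrite [RHS](big_nat_widen _ _ M)//; exact: eq_bigl.
have exV a : expi (- (2 * pi *+ a) : R) = 1.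
  have : expi (- (2 * pi *+ a) : R) * expi (2 * pi *+ a) = 1.
    by rewrite -expiD addNr /expi cos0 sin0.
  by rewrite expiMn expi1 expr1n mulr1.
case: ifPn => [/dvdnP[a kE]|nck].
  have -> : z = 1.
    by rewrite -(exV a) /z; congr expi; rewrite kE natrM -mulr_natr; field.
  under eq_bigr do rewrite expr1n.
  by rewrite sumr_const_nat subn1.
have zc : z ^+ c = 1.
  by rewrite -(exV k) -zj; congr expi; rewrite -mulr_natr; field.
(* With r = k mod c, the factor e^(2 pi i r / c) brings z back to 1, and it is not 1 because its
   angle lies strictly between 0 and 2 pi. *)
have z1 : z != 1.
  have zV : z * expi (2 * pi * (k %% c)%N%:R / c%:R) = 1.
    rewrite -expiD -(exV (k %/ c)%N); congr expi.
    rewrite {1}(divn_eq k c) natrD natrM -mulr_natr; field => //.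
  have := @expi_eq1 (2 * pi * (k %% c)%N%:R / c%:R).
  have piP := pi_gt0 R; have r0 : 0 < (k %% c)%N%:R :> R.
    by rewrite ltr0n lt0n.
  have rc : (k %% c)%N%:R < c%:R :> R by rewrite ltr_nat ltn_mod.
  have c0R : 0 < c%:R :> R by rewrite ltr0n.
  rewrite divr_gt0 ?mulr_gt0//= ltr_pdivrMr// ltr_pM2l ?mulr_gt0// rc => /(_ isT) H.
  by apply: contra H => /eqP z1; move: zV; rewrite z1 mul1r => ->.
(* The product telescopes to z^(c+1) - z, which vanishes as z^c = 1. *)
have : (z - 1) * \sum_(1 <= j < c.+1) z ^+ j = 0.
  rewrite mulr_sumr (eq_bigr (fun j => z ^+ j.+1 - z ^+ j)) => [|j _].
    by rewrite telescope_sumr// exprS zc mulr1 expr1 subrr.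
  by rewrite mulrBl mul1r exprS.
by move/eqP; rewrite mulf_eq0 subr_eq0 (negPf z1) => /eqP.
Qed.

(** Detect coprimality of a and q by the sum of mu(d) over d dividing both. After exchanging sums, a
    = d j runs over a complete character sum modulo q/d; replacing d by q/d gives the stated
    form. *)
Lemma ramanujan_sumE q k M : squarefree q -> (q < M)%N ->
  ramanujan_sum R q (- k%:Z)
  = (\sum_(1 <= d < M | (d %| q)%N && (d %| k)%N) (mobius (q %/ d)%N)%:~R * d%:R)%:C.
Proof.
move=> sq qM; have q0 := squarefree_gt0 _ sq.
pose f a : R[i] := expi (- (2 * pi * k%:R * a%:R / q%:R)).
transitivity (\sum_(1 <= a < q.+1) \sum_(1 <= d < q.+1 | (d %| a)%N && (d %| q)%N)
    (mobius d)%:~R * f a).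
  rewrite /ramanujan_sum big_mkcond /= !big_nat; apply: eq_bigr => a /andP[a0 aq].
  rewrite (eq_bigl (fun d => d %| gcdn a q)%N) => [|d]; last by rewrite dvdn_gcd.
  rewrite -mulr_suml -raddf_sum /= sum_mobius; last 2 first.
  - exact: squarefree_dvd (dvdn_gcdr a q) sq.
  - by rewrite ltnS dvdn_leq// dvdn_gcdr.
  rewrite -/(coprime a q); case: (coprime a q); rewrite ?mul0r// mul1r.
  by rewrite /f; congr expi; rewrite mulrNz; ring.
rewrite (exchange_big_dep_nat (fun d => d %| q)%N) /=; last by move=> a d _ _ _ /andP[].
transitivity (\sum_(1 <= d < q.+1 | (d %| q)%N) (mobius d)%:~R *
   (if (q %/ d %| k)%N then (q %/ d)%N%:R else 0 : R[i])).
  rewrite [LHS]big_nat_cond [RHS]big_nat_cond; apply: eq_bigr => d /andP[/andP[d0 dq] ddq].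
  rewrite (eq_bigl (fun a => d %| a)%N) => [|a]; last by rewrite ddq andbT.
  rewrite sum_multiples// -mulr_sumr -(@sum_expi (q %/ d)%N k q.+1); last first.
    by rewrite ltnS leq_divLR// leq_pmulr// divn_gt0// -ltnS dq.
  congr (_ * _); rewrite (eq_bigl (fun j => j <= q %/ d)%N) => [|j]; last first.
    by rewrite ltnS leq_divRL// mulnC.
  apply: eq_bigr => j _; rewrite /f; congr expi.
  have dN0 : d%:R != 0 :> R by rewrite pnatr_eq0 -lt0n.
  have qN0 : q%:R != 0 :> R by rewrite pnatr_eq0 -lt0n.
  rewrite natrM natf_div//; field; by rewrite dN0.
rewrite -(@sum_divisors_flip _ _ q.+1) ?q0 //=.
rewrite -(@sum_divisors_range _ q M) ?q0// raddf_sum [RHS]big_mkcondr /=.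
apply: eq_bigr => d dq; rewrite divnA// mulKn//; case: ifP => _; rewrite ?mulr0//.
by rewrite rmorphM /= rmorph_int rmorph_nat.
Qed.

End RamanujanSum.

(** * Power sums *)

Section PowerSums.
Variable R : realType.
Implicit Types (a : R) (n m M : nat).

Lemma gt0_powRD (x r s : R) : 0 < x -> x `^ (r + s) = x `^ r * x `^ s.
Proof. by move=> x0; rewrite powRD// (gt_eqF x0) implybT. Qed.

(** Discrete form of integrating x^(-1-a) over [n, n+1]: with X = n + 1, (n/X)^(-a) = exp(-a ln(1 -
    1/X)) >= 1 + a/X. *)
Lemma powR_neg_telescope a n : 0 < a -> (0 < n)%N ->
  n.+1%:R `^ (- (1 + a)) <= (n%:R `^ (- a) - n.+1%:R `^ (- a)) / a.
Proof.
move=> a0 n0; have n0R : 0 < n%:R :> R by rewrite ltr0n.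
have X0 : 0 < n.+1%:R :> R by rewrite ltr0n.
set X := n.+1%:R in X0 *; have XE : X = n%:R + 1 by rewrite /X -natr1.
rewrite ler_pdivlMr//.
have -> : n%:R = X * (n%:R / X) by rewrite mulrC divfK// gt_eqF.
have t0 : 0 < n%:R / X by rewrite divr_gt0.
rewrite (powRM _ (ltW X0) (ltW t0)) opprD gt0_powRD//.
rewrite powR_inv1 ?(ltW X0)//.
have H : 1 + a / X <= (n%:R / X) `^ (- a).
  rewrite /powR gt_eqF//; apply: le_trans (expR_ge1Dx _); rewrite lerD2l.
  have : ln (n%:R / X) <= - X^-1.
    have -> : n%:R / X = 1 - X^-1 by rewrite XE; field; rewrite -XE gt_eqF.
    by apply: le_ln1Dx; rewrite ltrN2 invf_lt1// XE; lra.
  by move=> L; rewrite mulNr -mulrN ler_pM2l// lerNr.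
have := powR_gt0 (- a) X0; set Y := X `^ _ => Y0.
have := ler_wpM2l (ltW Y0) H; rewrite mulrDr mulr1 -lerBrDl.
by have -> : Y * (a / X) = X^-1 * Y * a by ring.
Qed.

Lemma sum_powR_tail a m M : 0 < a -> (0 < m)%N ->
  \sum_(m.+1 <= n < M) n%:R `^ (- (1 + a)) <= m%:R `^ (- a) / a.
Proof.
move=> a0 m0; have [Mm|mM] := leqP M m.+1.
  by rewrite big_geq// divr_ge0 ?powR_ge0// ltW.
pose f n : R := - (n.-1%:R `^ (- a) / a).
apply: (@le_trans _ _ (\sum_(m.+1 <= n < M) (f n.+1 - f n))).
  rewrite [leLHS]big_nat [leRHS]big_nat; apply: ler_sum => -[//|n] /andP[mn _].
  have := @powR_neg_telescope a n a0 (leq_trans m0 mn).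
  by rewrite /f /= opprK mulrBl [_ / a - _]addrC.
rewrite telescope_sumr ?(ltnW mM)// /f opprK gerDr oppr_le0.
by rewrite divr_ge0 ?powR_ge0// ltW.
Qed.

Lemma sum_powR_neg a M : 0 < a ->
  \sum_(1 <= n < M) n%:R `^ (- (1 + a)) <= 1 + a^-1.
Proof.
move=> a0; have [M1|M1] := leqP M 1; first by rewrite big_geq// addr_ge0// invr_ge0 ltW.
rewrite big_ltn// powR1 lerD2l.
by have := @sum_powR_tail a 1 M a0 isT; rewrite powR1 mul1r.
Qed.

(** Induction on m. The new term X^(a-1), X = m + 1, fits because m^a <= X^a (1 - a/(2X)); the
    factor 2 in 2/a pays for using (1 + u)^(-1) <= 1 - u/2 on [0, 1]. *)
Lemma sum_powR_head a m : 0 < a -> a <= 1 ->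
  \sum_(1 <= n < m.+1) n%:R `^ (a - 1) <= 2 / a * m%:R `^ a.
Proof.
move=> a0 a1; elim: m => [|m IH]; first by rewrite big_geq// mulr_ge0 ?powR_ge0// divr_ge0 ?ltW.
rewrite big_nat_recr//=; have [->|m0] := posnP m.
  by rewrite big_geq// !powR1 add0r mulr1 ler_pdivlMr//; lra.
apply: (le_trans (lerD IH (lexx _))).
have m0R : 0 < m%:R :> R by rewrite ltr0n.
have X0 : 0 < m.+1%:R :> R by rewrite ltr0n.
set X := m.+1%:R in X0 *; have XE : X = m%:R + 1 by rewrite /X -natr1.
have -> : m%:R = X * (m%:R / X) by rewrite mulrC divfK// gt_eqF.
have t0 : 0 < m%:R / X by rewrite divr_gt0.
rewrite (powRM _ (ltW X0) (ltW t0)) gt0_powRD//.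
rewrite powR_inv1 ?(ltW X0)//.
have V0 : 0 < X^-1 by rewrite invr_gt0.
have V1 : X^-1 <= 1 by rewrite invf_le1// XE; lra.
have H : (m%:R / X) `^ a <= (1 + a / X)^-1.
  rewrite /powR gt_eqF// -[_ * _]opprK expRN lef_pV2 ?posrE ?expR_gt0//; last first.
    by rewrite addr_gt0// mulr_gt0.
  apply: le_trans (expR_ge1Dx _); rewrite lerD2l.
  have : ln (m%:R / X) <= - X^-1.
    have -> : m%:R / X = 1 - X^-1 by rewrite XE; field; rewrite -XE gt_eqF.
    by apply: le_ln1Dx; rewrite ltrN2 invf_lt1// XE; lra.
  by move=> L; rewrite -mulrN ler_pM2l// lerNr.
have H2 : (1 + a / X)^-1 <= 1 - a / X / 2.
  have u0 : 0 < a / X by rewrite mulr_gt0.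
  have u1 : a / X <= 1 by apply: mulr_ile1 => //; exact: ltW.
  move: (a / X) u0 u1 => u u0 u1.
  by rewrite -[leLHS]mul1r ler_pdivrMr; nra.
have Y0 := powR_gt0 a X0.
have E : 2 / a * (X `^ a) = 2 / a * (X `^ a * (1 - a / X / 2)) + X `^ a * X^-1.
  by field; rewrite !gt_eqF.
rewrite E lerD2r ler_pM2l ?divr_gt0// ler_pM2l//; exact: le_trans H H2.
Qed.

(** Split at n = m: below, bound the denominator from below by m and use [sum_powR_head]; above,
    bound it by n and use [sum_powR_tail]. *)
Lemma sum_powR_shift a m M : 0 < a -> a < 1 -> (0 < m)%N ->
  \sum_(1 <= n < M) n%:R `^ (- a) / (n + m)%N%:R
  <= (2 / (1 - a) + a^-1) * m%:R `^ (- a).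
Proof.
move=> a0 a1 m0; have m0R : 0 < m%:R :> R by rewrite ltr0n.
case: M => [|M].
  rewrite big_geq// mulr_ge0 ?powR_ge0// addr_ge0 ?invr_ge0 ?(ltW a0)//.
  by rewrite divr_ge0// subr_ge0 ltW.
(* Lengthening the range places the splitting point m + 1 inside it. *)
apply: (@le_trans _ _ (\sum_(1 <= n < (m + M).+1) n%:R `^ (- a) / (n + m)%N%:R)).
  rewrite (@big_cat_nat _ _ _ M.+1 1 (m + M).+1)//=; last by rewrite ltnS leq_addl.
  by rewrite lerDl sumr_ge0// => n _; rewrite divr_ge0 ?powR_ge0.
rewrite (@big_cat_nat _ _ _ m.+1)//=; last by lia.
rewrite mulrDl; apply: lerD.
  apply: (@le_trans _ _ (\sum_(1 <= n < m.+1) n%:R `^ ((1 - a) - 1) / m%:R)).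
    rewrite [leLHS]big_nat [leRHS]big_nat; apply: ler_sum => n /andP[n0 _].
    rewrite addrAC subrr add0r ler_wpM2l ?powR_ge0// lef_pV2 ?posrE ?ltr0n//; last by lia.
    by rewrite ler_nat leq_addl.
  rewrite -mulr_suml ler_pdivrMr//.
  apply: (le_trans (@sum_powR_head (1 - a) m _ _)); [lra|lra|].
  rewrite -[leRHS]mulrA ler_wpM2l//; first by rewrite divr_ge0//; lra.
  by rewrite gt0_powRD// powRr1 ?(ltW m0R)// mulrC.
rewrite mulrC; apply: le_trans (@sum_powR_tail a m (m + M).+1 a0 m0).
rewrite [leLHS]big_nat [leRHS]big_nat; apply: ler_sum => n /andP[n0 _].
have n0R : 0 < n%:R :> R by rewrite ltr0n; lia.
rewrite opprD gt0_powRD// powR_inv1 ?(ltW n0R)// mulrC ler_wpM2r ?powR_ge0//.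
by rewrite lef_pV2 ?posrE// ?ler_nat ?ltr0n ?leq_addr//; lia.
Qed.

(** A Riemann sum of step x for the integral of 1/(1+t)^2, compared with the telescoping differences
    of x/(1 + j x). *)
Lemma sum_inv_sqr_shift (x : R) M : 0 < x ->
  \sum_(1 <= j < M) x ^+ 2 / (1 + j%:R * x) ^+ 2 <= x.
Proof.
move=> x0; have [M1|M1] := leqP M 1; first by rewrite big_geq// ltW.
pose f j : R := - (x / (1 + j.-1%:R * x)).
apply: (@le_trans _ _ (\sum_(1 <= j < M) (f j.+1 - f j))).
  rewrite [leLHS]big_nat [leRHS]big_nat; apply: ler_sum => -[//|j] _.
  rewrite /f /= opprK -natr1; set y := 1 + j%:R * x.
  have y0 : 0 < y by rewrite ltr_pwDl// mulr_ge0// ltW.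
  have -> : 1 + (j%:R + 1) * x = y + x by rewrite /y; ring.
  have yx0 : 0 < y + x by rewrite addr_gt0.
  have -> : - (x / (y + x)) + x / y = x ^+ 2 / (y * (y + x)).
    by field; rewrite !gt_eqF.
  rewrite ler_pM2l ?exprn_gt0// lef_pV2 ?posrE ?exprn_gt0 ?mulr_gt0//.
  by rewrite expr2 ler_pM2r// lerDl ltW.
rewrite telescope_sumr ?(ltnW M1)// /f /= opprK mul0r addr0 divr1 gerDr oppr_le0.
by rewrite divr_ge0 ?ltW// ltr_pwDl// mulr_ge0// ltW.
Qed.

End PowerSums.

(** * Averages of q / phi(q) *)

Lemma leq_totient n : (totient n <= n)%N.
Proof.
rewrite totient_count_coprime -[leqRHS]subn0 -[leqRHS]muln1 -sum_nat_const_nat.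
by apply: leq_sum => i _; case: coprime.
Qed.

Section Averages.
Variable R : realType.
Implicit Types (w : nat -> R) (B : R) (d e n M : nat).

Definition sqf_ratio n : R := (squarefree n)%:R * (n%:R / (totient n)%:R).

Lemma sqf_ratio_ge0 n : 0 <= sqf_ratio n.
Proof. by rewrite mulr_ge0// divr_ge0. Qed.

Lemma sqf_ratio1 : sqf_ratio 1 = 1.
Proof. by rewrite /sqf_ratio /squarefree /= mul1r divr1. Qed.

(** If d e is squarefree, then d and e are coprime and equality holds; otherwise the left side is 0.
    Extending q/phi(q) by 0 is what gives submultiplicativity for all pairs. *)
Lemma sqf_ratioM d e : sqf_ratio (d * e) <= sqf_ratio d * sqf_ratio e.
Proof.
rewrite {1}/sqf_ratio; case sde : (squarefree (d * e)); last first.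
  by rewrite mul0r mulr_ge0 ?sqf_ratio_ge0.
rewrite /sqf_ratio (squarefree_dvd _ _ (dvdn_mulr e (dvdnn d)) sde).
rewrite (squarefree_dvd _ _ (dvdn_mull d (dvdnn e)) sde) !mul1r.
by rewrite totient_coprime ?squarefree_coprime// !natrM invfM mulrACA.
Qed.

Lemma sqf_ratio_ge1 n : squarefree n -> 1 <= sqf_ratio n.
Proof.
move=> sn; have n0 := squarefree_gt0 _ sn.
rewrite /sqf_ratio sn mul1r ler_pdivlMr ?ltr0n ?totient_gt0// mul1r ler_nat.
exact: leq_totient.
Qed.

Lemma sqf_ratio_exp2_le4 n : sqf_ratio n ^+ 2 <= sqf_ratio n ^+ 4.
Proof.
case sn : (squarefree n); first by apply: ler_weXn2l => //; exact: sqf_ratio_ge1.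
by rewrite /sqf_ratio sn mul0r !expr0n.
Qed.

Lemma sqf_ratio_prime p : prime p -> sqf_ratio p = (1 - p%:R^-1)^-1.
Proof.
move=> pp; have p1 := prime_gt1 pp.
have -> : sqf_ratio p = p%:R / (p.-1)%:R.
  rewrite /sqf_ratio -{1 3}(expn1 p) totient_pfactor// expn0 muln1.
  suff -> : squarefree (p ^ 1) by rewrite mul1r.
  rewrite expn1; apply/squarefreeP; rewrite prime_gt0//; split => // q pq.
  rewrite expnS expn1; apply/negP => qp.
  have /eqP qE : q == p by rewrite -dvdn_prime2// (dvdn_trans _ qp)// dvdn_mulr.
  by have := dvdn_leq (prime_gt0 pp) qp; rewrite qE; nia.
have pE : p%:R = p.-1%:R + 1 :> R by rewrite natr1 prednK// ltnW.
have p0 : 0 < p.-1%:R :> R by rewrite ltr0n; lia.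
rewrite pE; move: p.-1%:R p0 => t t0; field.
by rewrite addrK !gt_eqF// addr_gt0.
Qed.

(* The factor [gcdn d P] makes [1 + divisor_weight P p] dominate
   [(1 - 1/p)^-4] also at the small primes, where [1 + 1/sqrt p] does not. *)
Definition divisor_weight (P : nat) d : R :=
  (gcdn d P)%:R ^+ 5 / Num.sqrt d%:R.

Lemma divisor_weight_ge0 P d : 0 <= divisor_weight P d.
Proof. by rewrite divr_ge0 ?sqrtr_ge0. Qed.

(** For coprime d and e, gcd(d, P) gcd(e, P) divides gcd(d e, P). *)
Lemma divisor_weightM P d e : (0 < P)%N -> coprime d e ->
  divisor_weight P d * divisor_weight P e <= divisor_weight P (d * e).
Proof.
move=> P0 de; rewrite /divisor_weight mulrACA -invfM -exprMn -natrM.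
rewrite [in leRHS]natrM sqrtrM// ler_wpM2r ?invr_ge0 ?mulr_ge0 ?sqrtr_ge0//.
rewrite lerXn2r ?nnegrE// ler_nat dvdn_leq ?gcdn_gt0 ?P0 ?orbT//.
rewrite dvdn_gcd dvdn_mul ?dvdn_gcdl//= Gauss_dvd ?dvdn_gcdr//.
apply: coprime_dvdl (dvdn_gcdl _ _) _; exact: coprime_dvdr (dvdn_gcdl _ _) _.
Qed.

(** For p <= 25 the weight is p^(9/2), while (1 - 1/p)^(-4) <= 16 <= p^4. For larger p put u =
    p^(-1/2) <= 1/5: then (1 - u^2)^4 >= 1 - 4 u^2 and (1 + u)(1 - 4 u^2) >= 1, which is where the
    threshold 25 comes from. *)
Lemma sqf_ratio_prime_exp4 P p : (0 < P)%N ->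
  (forall q, prime q -> (q <= 25)%N -> (q %| P)%N) ->
  prime p -> sqf_ratio p ^+ 4 <= 1 + divisor_weight P p.
Proof.
move=> P0 HP pp; have p1 := prime_gt1 pp.
rewrite sqf_ratio_prime// /divisor_weight exprVn.
have p0 : 0 < p%:R :> R by rewrite ltr0n; lia.
set x := Num.sqrt p%:R; have x0 : 0 < x by rewrite sqrtr_gt0.
have xE : p%:R = x ^+ 2 by rewrite sqr_sqrtr// ltW.
have g1 : 1 <= (gcdn p P)%:R ^+ 5 :> R.
  by rewrite exprn_ege1// ler1n gcdn_gt0 P0 orbT.
have p2 : 2 <= p%:R :> R by rewrite ler_nat.
have [p25|p25] := leqP p 25.
  have -> : gcdn p P = p by apply/gcdn_idPl; exact: HP.
  have i2 : 2^-1 <= 1 - p%:R^-1 :> R.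
    have : p%:R^-1 <= 2^-1 :> R by rewrite lef_pV2 ?posrE.
    by lra.
  have i4 : (1 - p%:R^-1) ^- 4 <= (2 : R) ^+ 4.
    rewrite -[leRHS]invrK lef_pV2 ?posrE ?invr_gt0 ?exprn_gt0//; last by lra.
    by rewrite -exprVn lerXn2r ?nnegrE//; lra.
  apply: (le_trans i4); have x1 : 1 <= x by nra.
  have -> : p%:R ^+ 5 / x = x ^+ 9 by rewrite xE; field; rewrite gt_eqF.
  have : x ^+ 9 = p%:R ^+ 4 * x by rewrite xE; ring.
  have : (2 : R) ^+ 4 <= p%:R ^+ 4 by rewrite lerXn2r ?nnegrE.
  move: (p%:R ^+ 4) => t; nra.
apply: (@le_trans _ _ (1 + x^-1)); last first.
  by rewrite lerD2l ler_peMl ?invr_ge0 ?(ltW x0).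
set u := x^-1; have u0 : 0 < u by rewrite invr_gt0.
have -> : p%:R^-1 = u ^+ 2 by rewrite xE exprVn.
have u5 : u <= 5^-1.
  rewrite lef_pV2 ?posrE//.
  have : 5 ^+ 2 <= x ^+ 2 by rewrite -xE -natrX ler_nat; lia.
  by rewrite ler_pXn2r ?nnegrE ?(ltW x0).
have v0 : 0 < 1 - u ^+ 2 by nra.
rewrite -[leLHS]mul1r ler_pdivrMr ?exprn_gt0//.
have b : 1 - 4 * u ^+ 2 <= (1 - u ^+ 2) ^+ 4.
  have : 0 <= u ^+ 2 by exact: sqr_ge0.
  have : u ^+ 2 <= 1 by lra.
  move: (u ^+ 2) => v v1 v2.
  have -> : (1 - v) ^+ 4 = 1 - 4 * v + v ^+ 2 * (2 + (2 - v) ^+ 2) by ring.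
  by rewrite lerDl mulr_ge0 ?sqr_ge0// addr_ge0 ?sqr_ge0.
apply: (@le_trans _ _ ((1 + u) * (1 - 4 * u ^+ 2))); last by rewrite ler_pM2l//; lra.
nra.
Qed.

(** Induction over the prime factors: a new prime p multiplies the right side by at least 1 +
    [divisor_weight P p], since the divisors d of m are joined by the p d. *)
Lemma sqf_ratio_exp4_le P n M : (0 < P)%N ->
  (forall q, prime q -> (q <= 25)%N -> (q %| P)%N) -> (n < M)%N ->
  sqf_ratio n ^+ 4 <= \sum_(1 <= d < M | (d %| n)%N) divisor_weight P d.
Proof.
move=> P0 HP; case sn : (squarefree n); last first.
  move=> _; rewrite /sqf_ratio sn mul0r expr0n /= sumr_ge0// => d _.
  exact: divisor_weight_ge0.
elim/squarefree_ind: n / sn => [M1|p m pp pm spm IH pmM].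
  rewrite sqf_ratio1 expr1n (eq_bigl (fun d => d == 1%N)) => [|d]; last by rewrite dvdn1.
  by rewrite big_nat1_eq M1 /= /divisor_weight gcd1n expr1n sqrtr1 divr1.
have m0 : (0 < m)%N by move: (squarefree_gt0 _ spm); rewrite muln_gt0 => /andP[].
rewrite sum_divisors_prime//.
apply: (@le_trans _ _ (sqf_ratio p ^+ 4 * sqf_ratio m ^+ 4)).
  by rewrite -exprMn lerXn2r ?nnegrE ?mulr_ge0 ?sqf_ratio_ge0// sqf_ratioM.
have mM : (m < M)%N by apply: leq_ltn_trans pmM; rewrite leq_pmull// prime_gt0.
apply: (@le_trans _ _ ((1 + divisor_weight P p) *
    \sum_(1 <= d < M | (d %| m)%N) divisor_weight P d)).
  by apply: ler_pM; rewrite ?exprn_ge0 ?sqf_ratio_ge0 ?sqf_ratio_prime_exp4 ?IH.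
rewrite mulrDl mul1r lerD2l mulr_sumr; apply: ler_sum => d dm.
rewrite divisor_weightM// prime_coprime//; apply: contra pm => /dvdn_trans; exact.
Qed.

(** By monotonicity, e w(e j) is at most the sum of w over the block of e integers ending at e j,
    and these blocks are disjoint. *)
Lemma sum_weight_multiples w B e M : (0 < e)%N ->
  (forall i j, (0 < i <= j)%N -> w j <= w i) ->
  (forall K, \sum_(1 <= n < K) w n <= B) ->
  \sum_(1 <= j < M) w (e * j)%N <= B / e%:R.
Proof.
move=> e0 wdecr wB; rewrite ler_pdivlMr ?ltr0n// mulrC.
have [->|] := posnP M; first by rewrite big_geq// mulr0; have := wB 0%N; rewrite big_geq.
case: M => // M _; apply: le_trans (wB (e * M).+1); elim: M => [|M IH].
  by rewrite muln0 !big_geq// mulr0.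
rewrite big_nat_recr//= mulrDr [leRHS](@big_cat_nat _ _ _ (e * M).+1)//=; last first.
  by rewrite mulnS; lia.
apply: lerD => //.
have -> : e%:R * w (e * M.+1)%N = \sum_((e * M).+1 <= n < (e * M.+1).+1) w (e * M.+1)%N.
  by rewrite sumr_const_nat subSS mulnS addnK mulr_natl.
rewrite [leLHS]big_nat [leRHS]big_nat; apply: ler_sum => n /andP[n1 n2].
by apply: wdecr; rewrite (leq_ltn_trans _ n1)//= -ltnS.
Qed.

(* Decreasing weights see [sqf_ratio n ^+ 4] as bounded: expand it over the
   divisors of [n] and sum first over their multiples. *)
Lemma sum_sqf_ratio_weight : exists2 C : R, 0 < C & forall w B M,
  (forall n, (0 < n)%N -> 0 <= w n) ->
  (forall i j, (0 < i <= j)%N -> w j <= w i) ->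
  (forall K, \sum_(1 <= n < K) w n <= B) ->
  \sum_(1 <= n < M) sqf_ratio n ^+ 4 * w n <= C * B.
Proof.
have [P P0 HP] : exists2 P, (0 < P)%N & forall q, prime q -> (q <= 25)%N -> (q %| P)%N.
  exists (25`!)%N; first exact: fact_gt0.
  by move=> q pq q25; rewrite dvdn_fact// q25 prime_gt0.
have P5 : 0 < P%:R ^+ 5 :> R by rewrite exprn_gt0// ltr0n.
(* As gcd(d, P) <= P, the weight of d times B/d is at most P^5 B d^(-3/2), and the sum of d^(-3/2)
   is at most 3. *)
exists (P%:R ^+ 5 * 3); first by rewrite mulr_gt0.
move=> w B M w0 wdecr wB; have B0 : 0 <= B by have := wB 0%N; rewrite big_geq.
apply: (@le_trans _ _ (\sum_(1 <= n < M)
    \sum_(1 <= d < M | (d %| n)%N) divisor_weight P d * w n)).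
  rewrite [leLHS]big_nat [leRHS]big_nat; apply: ler_sum => n /andP[n0 nM].
  by rewrite -mulr_suml ler_wpM2r ?w0// sqf_ratio_exp4_le.
rewrite (exchange_big_dep_nat xpredT)//=.
apply: (@le_trans _ _ (\sum_(1 <= d < M) (P%:R ^+ 5 * B) * d%:R `^ (- (1 + 2^-1)))); last first.
  rewrite -mulr_sumr [leRHS]mulrAC; apply: ler_wpM2l; first by rewrite mulr_ge0// ltW.
  apply: le_trans (@sum_powR_neg R 2^-1 M _) _; first by rewrite invr_gt0.
  by rewrite invrK; lra.
rewrite [leLHS]big_nat [leRHS]big_nat; apply: ler_sum => d /andP[d0 dM].
have d0R : 0 < d%:R :> R by rewrite ltr0n.
rewrite -mulr_sumr sum_multiples// big_mkcond /=.
apply: (@le_trans _ _ (divisor_weight P d * (B / d%:R))).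
  rewrite ler_wpM2l ?divisor_weight_ge0//.
  apply: le_trans (@sum_weight_multiples w B d M d0 wdecr wB).
  rewrite [leLHS]big_nat [leRHS]big_nat; apply: ler_sum => j /andP[j0 _].
  by case: ifP => // _; rewrite w0// muln_gt0 d0.
rewrite opprD gt0_powRD// powR_inv1 ?(ltW d0R)// powRN powR12_sqrt ?(ltW d0R)//.
rewrite /divisor_weight.
have -> : (gcdn d P)%:R ^+ 5 / Num.sqrt d%:R * (B / d%:R)
  = (gcdn d P)%:R ^+ 5 * (B * (d%:R^-1 / Num.sqrt d%:R)) by ring.
rewrite -[leRHS]mulrA ler_wpM2r ?mulr_ge0 ?invr_ge0 ?sqrtr_ge0//.
by rewrite lerXn2r ?nnegrE// ler_nat dvdn_leq// dvdn_gcdr.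
Qed.

End Averages.

(** * Second moments of divisor sums *)

Section SecondMoment.
Variable R : realType.
Implicit Types (N s : R) (c f g : nat -> R) (d e n m D M : nat).

(* Compares (N - t)^2 with its integral over each step of length D. *)
Lemma sum_sqr_progression N D J : (D * J)%N%:R <= N ->
  0 <= N ^+ 3 - (N - (D * J)%N%:R) ^+ 3
       - 3 * D%:R * \sum_(1 <= j < J.+1) (N - (D * j)%N%:R) ^+ 2
    <= 3 * D%:R * (N ^+ 2 - (N - (D * J)%N%:R) ^+ 2).
Proof.
have D0 : 0 <= D%:R :> R by [].
elim: J => [|J IH]; first by rewrite muln0 subr0 !subrr big_geq// !mulr0 subr0 lexx.
move=> DN; have /IH : (D * J)%N%:R <= N.
  by apply: le_trans DN; rewrite ler_nat leq_mul2l leqnSn orbT.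
rewrite [X in _ -> 0 <= _ - _ * X <= _]big_nat_recr//=.
move: (\sum_(1 <= j < J.+1) (N - (D * j)%N%:R) ^+ 2) => S.
have -> : N - (D * J)%N%:R = (N - (D * J.+1)%N%:R) + D%:R.
  by rewrite mulnS natrD; ring.
have : 0 <= N - (D * J.+1)%N%:R by rewrite subr_ge0.
move: (N - _) (D%:R) D0 => v t t0 v0 /andP[H1 H2].
have vt : 0 <= v * t ^+ 2 by rewrite mulr_ge0 ?sqr_ge0.
have t3 : 0 <= t ^+ 3 by rewrite exprn_ge0.
have E : N ^+ 3 - v ^+ 3 - 3 * t * (S + v ^+ 2)
  = (N ^+ 3 - (v + t) ^+ 3 - 3 * t * S) + (3 * (v * t ^+ 2) + t ^+ 3) by ring.
have E' : 3 * t * (N ^+ 2 - v ^+ 2)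
  = 3 * t * (N ^+ 2 - (v + t) ^+ 2) + (6 * (v * t ^+ 2) + 3 * t ^+ 3) by ring.
by rewrite E E'; apply/andP; split; lra.
Qed.

(** The sum falls short of its integral N^3/(3D) by at most N^2. For D <= N the factor (N/D)^s is at
    least 1; for D > N the main term itself is at most N^2 (N/D) <= N^2 (N/D)^s. *)
Lemma sum_sqr_multiples N s D : 0 < N -> (0 < D)%N -> 0 <= s -> s <= 1 ->
  `|\sum_(1 <= k < (Num.truncn N).+1 | (D %| k)%N) (N - k%:R) ^+ 2
    - N ^+ 3 / 3 / D%:R| <= N ^+ 2 * (N / D%:R) `^ s.
Proof.
move=> N0 D0 s0 s1; have DR : 0 < D%:R :> R by rewrite ltr0n.
have /andP[tN Nt] := truncn_itv (ltW N0).
set J := (Num.truncn N %/ D)%N.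
have -> : \sum_(1 <= k < (Num.truncn N).+1 | (D %| k)%N) (N - k%:R) ^+ 2
    = \sum_(1 <= j < J.+1) (N - (D * j)%N%:R) ^+ 2.
  rewrite sum_multiples// [RHS](big_nat_widen _ _ (Num.truncn N).+1); last first.
    by rewrite ltnS leq_div.
  by apply: eq_bigl => j; rewrite !ltnS leq_divRL// mulnC.
have DJ : (D * J)%N%:R <= N.
  by apply: le_trans tN; rewrite ler_nat mulnC leq_trunc_div.
have /andP[H1 H2] := @sum_sqr_progression N D J DJ.
have uD : N - (D * J)%N%:R <= D%:R.
  rewrite lerBlDr -natrD -mulnS; apply: (le_trans (ltW Nt)); rewrite ler_nat mulnC.
  exact: ltn_ceil.
have u0 : 0 <= N - (D * J)%N%:R by rewrite subr_ge0.
set S := \sum_(1 <= j < J.+1) (N - (D * j)%N%:R) ^+ 2 in H1 H2 *; set u := N - _ in H1 H2 uD u0.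
have u3 : 0 <= u ^+ 3 by rewrite exprn_ge0.
(* The leftover interval beyond the last multiple has length u <= D, so its cube is absorbed by the
   3 D u^2 available in [H2]. *)
have uu : u ^+ 3 <= D%:R * u ^+ 2 by rewrite exprS ler_wpM2r// sqr_ge0.
have Sle : S <= N ^+ 3 / 3 / D%:R.
  by rewrite !ler_pdivlMr//; move: H1; lra.
rewrite distrC ger0_norm ?subr_ge0//.
have key : N ^+ 3 / 3 / D%:R - S <= N ^+ 2.
  rewrite lerBlDr !ler_pdivrMr//.
  have : 0 <= D%:R * u ^+ 2 by rewrite mulr_ge0 ?sqr_ge0// ltW.
  by move: H2; lra.
have [DN|ND] := leP D%:R N.
  apply: (le_trans key); rewrite ler_peMr ?sqr_ge0//.
  apply: (@le_trans _ _ (1 `^ s)); first by rewrite powR1.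
  apply: ge0_ler_powR; rewrite ?nnegrE ?divr_ge0// ?(ltW N0)//.
  by rewrite ler_pdivlMr// mul1r.
have S0 : 0 <= S by apply: sumr_ge0 => j _; exact: sqr_ge0.
apply: (@le_trans _ _ (N ^+ 2 * (N / D%:R))); last first.
  rewrite ler_wpM2l ?sqr_ge0// -[leLHS]powRr1 ?divr_ge0// ?(ltW N0)//.
  by apply: ger_powR => //; rewrite divr_gt0//= ler_pdivrMr// mul1r ltW.
have -> : N ^+ 2 * (N / D%:R) = 3 * (N ^+ 3 / 3 / D%:R).
  by field; rewrite gt_eqF.
by move: Sle S0; move: (_ / _) => x; lra.
Qed.

(** An e divides gcd(d, d') exactly when it divides both, so for fixed e the double sum factors. It
    serves with c = phi for the main term and c(e) = e^s for the error. *)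
Lemma sum_gcd_squares c f M :
  \sum_(1 <= d < M) \sum_(1 <= d' < M)
     (\sum_(1 <= e < M | (e %| gcdn d d')%N) c e) * (f d * f d')
  = \sum_(1 <= e < M) c e * (\sum_(1 <= d < M | (e %| d)%N) f d) ^+ 2.
Proof.
transitivity (\sum_(1 <= e < M) \sum_(1 <= d < M) \sum_(1 <= d' < M)
   (if (e %| gcdn d d')%N then c e * (f d * f d') else 0)).
  rewrite [RHS]exchange_big; apply: eq_bigr => d _.
  rewrite [RHS]exchange_big; apply: eq_bigr => d' _.
  by rewrite mulr_suml big_mkcond.
apply: eq_bigr => e _; rewrite expr2 mulr_suml mulr_sumr big_mkcond.
rewrite [RHS]big_mkcond; apply: eq_bigr => d _.
case: ifPn => ed; last first.
  by rewrite big1// => d' _; rewrite dvdn_gcd (negPf ed).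
rewrite !mulr_sumr [RHS]big_mkcond; apply: eq_bigr => d' _.
by rewrite dvdn_gcd ed.
Qed.

Lemma sum_totient n M : (0 < n < M)%N ->
  \sum_(1 <= e < M | (e %| n)%N) (totient e)%:R = n%:R :> R.
Proof.
move=> /andP[n0 nM]; rewrite -[in RHS](sum_totient_dvd n) natr_sum.
rewrite -(big_mkord (fun d => d %| n)%N (fun d => (totient d)%:R)).
rewrite [RHS]big_ltn_cond// dvd0n gtn_eqF//; apply: sum_divisors_range.
by rewrite n0.
Qed.

(* By [sum_sqr_multiples], each pair (d, d') costs N^2 (N / lcm(d, d'))^s; the
   sum over pairs decouples through gcd(d, d')^s <= sum_(e | d, e | d') e^s. *)
Lemma second_moment_error N s g M : 0 < N -> 0 <= s -> s <= 1 ->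
  `|\sum_(1 <= k < (Num.truncn N).+1)
       (N - k%:R) ^+ 2 * (\sum_(1 <= d < M | (d %| k)%N) g d) ^+ 2
    - N ^+ 3 / 3 * \sum_(1 <= d < M) \sum_(1 <= d' < M) g d * g d' / (lcmn d d')%:R|
  <= N ^+ 2 * N `^ s * \sum_(1 <= e < M)
       e%:R `^ s * (\sum_(1 <= d < M | (e %| d)%N) `|g d| * d%:R `^ (- s)) ^+ 2.
Proof.
move=> N0 s0 s1; set K := (Num.truncn N).+1.
have -> : \sum_(1 <= k < K) (N - k%:R) ^+ 2 * (\sum_(1 <= d < M | (d %| k)%N) g d) ^+ 2
  = \sum_(1 <= d < M) \sum_(1 <= d' < M) g d * g d' *
      \sum_(1 <= k < K | (lcmn d d' %| k)%N) (N - k%:R) ^+ 2.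
  transitivity (\sum_(1 <= k < K) \sum_(1 <= d < M) \sum_(1 <= d' < M)
     (if (lcmn d d' %| k)%N then g d * g d' * (N - k%:R) ^+ 2 else 0)).
    apply: eq_bigr => k _; rewrite [X in _ * X]expr2 mulr_suml mulr_sumr [LHS]big_mkcond.
    apply: eq_bigr => d _; case: ifPn => dk; last first.
      by rewrite big1// => d' _; rewrite dvdn_lcm (negPf dk).
    rewrite !mulr_sumr [LHS]big_mkcond; apply: eq_bigr => d' _.
    by rewrite dvdn_lcm dk /=; case: ifP => // _; rewrite mulrC.
  rewrite exchange_big; apply: eq_bigr => d _.
  rewrite exchange_big; apply: eq_bigr => d' _.
  by rewrite mulr_sumr [RHS]big_mkcond.
rewrite !mulr_sumr -sumrB; apply: (le_trans (ler_norm_sum _ _ _)).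
rewrite -mulr_sumr -sum_gcd_squares mulr_sumr.
rewrite [leLHS]big_nat [leRHS]big_nat; apply: ler_sum => d /andP[d0 dM].
rewrite !mulr_sumr -sumrB; apply: (le_trans (ler_norm_sum _ _ _)).
rewrite [leLHS]big_nat [leRHS]big_nat; apply: ler_sum => d' /andP[d'0 d'M].
have l0 : (0 < lcmn d d')%N by rewrite lcmn_gt0 d0.
have g0 : (0 < gcdn d d')%N by rewrite gcdn_gt0 d0.
rewrite [X in _ - X]mulrCA -mulrBr normrM normrM.
have := @sum_sqr_multiples N s (lcmn d d') N0 l0 s0 s1.
move/(ler_wpM2l (mulr_ge0 (normr_ge0 (g d)) (normr_ge0 (g d')))) => /le_trans; apply.
have dR : 0 < d%:R :> R by rewrite ltr0n.
have d'R : 0 < d'%:R :> R by rewrite ltr0n.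
have gR : 0 < (gcdn d d')%:R :> R by rewrite ltr0n.
have lR : 0 < (lcmn d d')%:R :> R by rewrite ltr0n.
have -> : N / (lcmn d d')%:R = N * ((gcdn d d')%:R * (d%:R^-1 * d'%:R^-1)).
  have : (lcmn d d')%:R * (gcdn d d')%:R = d%:R * d'%:R :> R by rewrite -!natrM muln_lcm_gcd.
  move=> E; rewrite -invfM -E; field; by rewrite !gt_eqF.
rewrite !powRM ?mulr_ge0 ?invr_ge0// ?(ltW N0)//.
rewrite !powRN -!(powR_inv1 (ler0n _ _)) -!powRrM mulN1r !powRN.
have : (gcdn d d')%:R `^ s <= \sum_(1 <= e < M | (e %| gcdn d d')%N) e%:R `^ s.
  rewrite big_mkcond (bigD1_seq (gcdn d d')) ?iota_uniq//=; last first.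
    rewrite mem_index_iota g0/=; apply: leq_ltn_trans dM; rewrite dvdn_leq//; exact: dvdn_gcdl.
  by rewrite dvdnn lerDl sumr_ge0// => e _; case: ifP => _; rewrite ?powR_ge0.
set G := _ `^ s; set Sg := \sum_(1 <= e < M | (e %| gcdn d d')%N) e%:R `^ s => GS.
set p := (d%:R `^ s)^-1; set p' := (d'%:R `^ s)^-1.
have -> : `|g d| * `|g d'| * (N ^+ 2 * (N `^ s * (G * (p * p'))))
  = (N ^+ 2 * N `^ s * (`|g d| * p * (`|g d'| * p'))) * G by ring.
have -> : N ^+ 2 * N `^ s * (Sg * (`|g d| * p * (`|g d'| * p')))
  = (N ^+ 2 * N `^ s * (`|g d| * p * (`|g d'| * p'))) * Sg by ring.
apply: ler_wpM2l => //.
by repeat apply: mulr_ge0; rewrite ?invr_ge0 ?powR_ge0 ?(ltW N0).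
Qed.

End SecondMoment.

(** * The truncated singular series *)

Section TruncatedTail.
Variable R : realType.
Implicit Types (N s : R) (d e k n m M : nat).

Definition tail_coef m M d : R :=
  \sum_(m.+1 <= q < M | (d %| q)%N)
    (squarefree q)%:R / (totient q)%:R ^+ 2 * (mobius (q %/ d)%N)%:~R.

Definition tail_sum m M k : R :=
  \sum_(1 <= d < M | (d %| k)%N) d%:R * tail_coef m M d.

Definition tail_mean m M : R :=
  \sum_(m.+1 <= q < M) (squarefree q)%:R / (totient q)%:R ^+ 3.

(** Exchanging the sums exposes, for squarefree q, the inner sum as c_q(-k) by [ramanujan_sumE]:
    [tail_sum] is the truncated tail of the singular series. *)
Lemma tail_sumE m M k : tail_sum m M k = \sum_(m.+1 <= q < M)
    (squarefree q)%:R / (totient q)%:R ^+ 2 *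
    \sum_(1 <= d < M | (d %| q)%N && (d %| k)%N) (mobius (q %/ d)%N)%:~R * d%:R.
Proof.
transitivity (\sum_(1 <= d < M | (d %| k)%N) \sum_(m.+1 <= q < M | (d %| q)%N)
  (squarefree q)%:R / (totient q)%:R ^+ 2 * ((mobius (q %/ d)%N)%:~R * d%:R) : R).
  by apply: eq_bigr => d _; rewrite mulr_sumr; apply: eq_bigr => q _; ring.
rewrite (exchange_big_dep xpredT)//=; apply: eq_bigr => q _.
by rewrite mulr_sumr; apply: eq_bigl => d; rewrite andbC.
Qed.

(** For fixed q = r e, the d with e | d | q are d = e j with j | r, and the sum of mu(r/j) over them
    vanishes unless r = 1. Only q = e survives. *)
Lemma sum_tail_coef m M e : (0 < e < M)%N ->
  \sum_(1 <= d < M | (e %| d)%N) tail_coef m M d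
  = (m < e)%N%:R * (squarefree e)%:R / (totient e)%:R ^+ 2.
Proof.
move=> /andP[e0 eM].
transitivity (\sum_(m.+1 <= q < M) (squarefree q)%:R / (totient q)%:R ^+ 2 *
   (q == e)%:R : R).
  rewrite (exchange_big_dep xpredT)//= [LHS]big_nat [RHS]big_nat.
  apply: eq_bigr => q /andP[mq qM].
  case sq : (squarefree q); last first.
    by rewrite !mul0r big1// => d _; rewrite !mul0r.
  rewrite -mulr_sumr; congr (_ * _).
  have q0 := squarefree_gt0 _ sq.
  have [/dvdnP[r qE]|neq] := boolP (e %| q)%N; last first.
    rewrite big1 => [|d /andP[ed dq]]; last by move: neq; rewrite (dvdn_trans ed).
    by case: eqP neq => // ->; rewrite dvdnn.
  rewrite big_mkcondr sum_multiples// big_mkcond /=.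
  transitivity (\sum_(1 <= j < M | (j %| r)%N) (mobius (r %/ j)%N)%:~R : R).
    rewrite [RHS]big_mkcond [LHS]big_nat [RHS]big_nat; apply: eq_bigr => j /andP[j0 jM].
    rewrite qE (mulnC r) dvdn_pmul2l// divnMl//.
    case: ifP => // ejM; case: ifP => // jr; move: ejM.
    rewrite (leq_ltn_trans _ qM)// qE mulnC leq_pmul2r// dvdn_leq//.
    by move: q0; rewrite qE muln_gt0 => /andP[].
  have r0 : (0 < r)%N by move: q0; rewrite qE muln_gt0 => /andP[].
  have rM : (r < M)%N by apply: leq_ltn_trans qM; rewrite qE leq_pmulr.
  rewrite (@sum_divisors_flip _ r M (fun d => (mobius d)%:~R)) ?r0//.
  rewrite -(raddf_sum (intmul (1 : R))) /= sum_mobius//; last first.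
    by apply: squarefree_dvd sq; rewrite qE dvdn_mulr.
  by rewrite qE -{2}[e]mul1n eqn_pmul2r//; case: eqP.
transitivity (\sum_(m.+1 <= q < M | q == e) (squarefree q)%:R / (totient q)%:R ^+ 2 : R).
  by rewrite [RHS]big_mkcond; apply: eq_bigr => q _; case: eqP; rewrite ?mulr1 ?mulr0.
by rewrite big_nat1_eq eM andbT; case: ltnP; rewrite ?mul1r ?mul0r.
Qed.

(* [gcdn d d'] is the sum of the totients of its divisors, so the form is
   diagonal in the sums computed by [sum_tail_coef]. *)
Lemma tail_coef_form m M :
  \sum_(1 <= d < M) \sum_(1 <= d' < M)
    (d%:R * tail_coef m M d) * (d'%:R * tail_coef m M d') / (lcmn d d')%:R
  = tail_mean m M.
Proof.
transitivity (\sum_(1 <= d < M) \sum_(1 <= d' < M)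
   (\sum_(1 <= e < M | (e %| gcdn d d')%N) (totient e)%:R) *
   (tail_coef m M d * tail_coef m M d')).
  rewrite [LHS]big_nat [RHS]big_nat; apply: eq_bigr => d /andP[d0 dM].
  rewrite [LHS]big_nat [RHS]big_nat; apply: eq_bigr => d' /andP[d'0 d'M].
  have g0 : (0 < gcdn d d')%N by rewrite gcdn_gt0 d0.
  rewrite sum_totient ?g0/=; last by apply: leq_ltn_trans dM; rewrite dvdn_leq// dvdn_gcdl.
  have lR : (lcmn d d')%:R != 0 :> R by rewrite pnatr_eq0 -lt0n lcmn_gt0 d0.
  have E : (lcmn d d')%:R * (gcdn d d')%:R = d%:R * d'%:R :> R by rewrite -!natrM muln_lcm_gcd.
  by rewrite mulrACA -E; field.
rewrite sum_gcd_squares /tail_mean.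
have [mM|Mm] := ltnP m.+1 M; last first.
  rewrite [RHS]big_geq// big_nat big1// => e /andP[e0 eM].
  rewrite sum_tail_coef ?e0// ltnNge (_ : (e <= m)%N = true) ?mul0r ?expr0n ?mulr0//.
  by rewrite -ltnS (leq_trans eM).
rewrite (@big_cat_nat _ _ _ m.+1)//= 1?ltnW// [X in X + _]big_nat big1 ?add0r; last first.
  move=> e /andP[e0 em]; rewrite sum_tail_coef ?e0 ?(ltn_trans em)//.
  by rewrite ltnNge -ltnS em !mul0r expr0n mulr0.
(* For e > m the diagonal term is phi(e) (1/phi(e)^2)^2 = 1/phi(e)^3. *)
rewrite [LHS]big_nat [RHS]big_nat; apply: eq_bigr => e /andP[me eM].
have e0 : (0 < e)%N by apply: leq_trans me.
rewrite sum_tail_coef ?e0// me mul1r.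
case: (squarefree e); rewrite ?mul0r ?expr0n ?mulr0// !mul1r.
have : (totient e)%:R != 0 :> R by rewrite pnatr_eq0 -lt0n totient_gt0.
by move: (_%:R) => t t0; field.
Qed.

End TruncatedTail.

(** * Bounds uniform in the truncation *)

Section Bounds.
Variable R : realType.
Implicit Types (N s : R) (d e k n m M : nat).

Lemma powRN2 n : n%:R `^ (- (1 + 1)) = n%:R ^- 2 :> R.
Proof. by rewrite powRN -[1 + 1]/(2%:R) powR_mulrn. Qed.

Lemma sqf_totient_sqr q : (0 < q)%N ->
  (squarefree q)%:R / (totient q)%:R ^+ 2 = (sqf_ratio R q / q%:R) ^+ 2.
Proof.
move=> q0; have qR : q%:R != 0 :> R by rewrite pnatr_eq0 -lt0n.
rewrite /sqf_ratio mulrA mulrAC mulfK// expr_div_n.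
by case: squarefree; rewrite ?expr1n// mul0r expr0n mul0r.
Qed.

Lemma normr_mobius_le1 q : `|(mobius q)%:~R : R| <= 1.
Proof.
rewrite /mobius; case: ifP => _; last by rewrite normr0.
by rewrite rmorphXn /= rmorphN1 normrX normrN1 expr1n.
Qed.

Lemma powR_decr (a : R) i j : a <= 0 -> (0 < i <= j)%N -> j%:R `^ a <= i%:R `^ a.
Proof.
move=> a0 /andP[i0 ij].
have iR : 0 < i%:R :> R by rewrite ltr0n.
have jR : 0 < j%:R :> R by rewrite ltr0n (leq_trans i0).
have [b b0 ->] : exists2 b, 0 <= b & a = - b.
  by exists (- a); rewrite ?oppr_ge0 ?opprK.
rewrite !powRN lef_pV2 ?posrE ?powR_gt0//.
by apply: ge0_ler_powR; rewrite ?nnegrE ?ler_nat// ltW.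
Qed.

(** Writing q = d j and h for [sqf_ratio], |a(d)| <= (h(d)/d)^2 S with S the sum of h(j)^4/j^2 over
    d j > m. Since S is O(min(1, d/m)), the claim follows. *)
Lemma tail_coef_bound : exists2 C : R, 0 < C & forall m M d, (0 < m)%N -> (0 < d)%N ->
  `|d%:R * tail_coef R m M d| <= C * sqf_ratio R d ^+ 2 / (d + m)%N%:R.
Proof.
have [C C0 HC] := sum_sqf_ratio_weight R.
(* 6 = 2 + 4, from S <= 2 C and S m/d <= 4 C. *)
exists (6 * C); first by rewrite mulr_gt0.
move=> m M d m0 d0.
have mR : 0 < m%:R :> R by rewrite ltr0n.
have dR : 0 < d%:R :> R by rewrite ltr0n.
set h := sqf_ratio R; have h0 n : 0 <= h n by exact: sqf_ratio_ge0.
pose S := \sum_(1 <= j < M | (m < d * j)%N) h j ^+ 4 * j%:R ^- 2.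
have coefS : `|tail_coef R m M d| <= (h d / d%:R) ^+ 2 * S.
  pose G q : R := if (m < q)%N then (h q / q%:R) ^+ 2 else 0.
  have G0 q : 0 <= G q by rewrite /G; case: ifP => // _; exact: sqr_ge0.
  apply: (@le_trans _ _ (\sum_(1 <= q < M | (d %| q)%N) G q)).
    have [Mm|mM] := leqP M m.+1.
      by rewrite /tail_coef big_geq// normr0 sumr_ge0.
    rewrite [leRHS](@big_cat_nat _ _ _ m.+1)//= 1?ltnW//.
    rewrite [X in _ <= X + _]big_nat_cond [X in _ <= X + _]big1 ?add0r; last first.
      by move=> q /andP[/andP[_ qm] _]; rewrite /G ltnNge -ltnS qm.
    apply: (le_trans (ler_norm_sum _ _ _)).
    rewrite [leLHS]big_nat_cond [leRHS]big_nat_cond.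
    apply: ler_sum => q /andP[/andP[mq qM] dq]; rewrite /G mq.
    have q0 : 0 < q%:R :> R by rewrite ltr0n; apply: leq_trans mq.
    rewrite normrM ger0_norm; last by rewrite divr_ge0// exprn_ge0.
    rewrite -sqf_totient_sqr; last exact: leq_trans mq.
    by rewrite ler_piMr ?normr_mobius_le1// divr_ge0// exprn_ge0.
  rewrite sum_multiples// mulr_sumr big_mkcond [leRHS]big_mkcond /=.
  rewrite [leLHS]big_nat [leRHS]big_nat; apply: ler_sum => j /andP[j0 jM].
  have jR : 0 < j%:R :> R by rewrite ltr0n.
  rewrite /G; case: (m < d * j)%N; last by case: ifP.
  apply: (@le_trans _ _ ((h (d * j)%N / (d * j)%N%:R) ^+ 2)).
    by case: ifP => // _; exact: sqr_ge0.
  apply: (@le_trans _ _ ((h d / d%:R) ^+ 2 * (h j ^+ 2 * j%:R ^- 2))); last first.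
    by rewrite ler_wpM2l ?sqr_ge0// ler_wpM2r ?invr_ge0 ?sqr_ge0// sqf_ratio_exp2_le4.
  rewrite -exprVn -exprMn -exprMn lerXn2r ?nnegrE ?mulr_ge0 ?invr_ge0 ?h0//.
  by rewrite natrM invfM [leRHS]mulrACA ler_wpM2r ?mulr_ge0 ?invr_ge0// sqf_ratioM.
have S2 : S <= C * 2.
  apply: (@le_trans _ _ (\sum_(1 <= j < M) h j ^+ 4 * j%:R ^- 2)).
    rewrite /S big_mkcond /=; apply: ler_sum => j _; case: ifP => // _.
    by rewrite mulr_ge0 ?invr_ge0 ?exprn_ge0.
  apply: HC => [n n0|i j /andP[i0 ij]|K]; first by rewrite invr_ge0 exprn_ge0.
    have iR : 0 < i%:R :> R by rewrite ltr0n.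
    have jR : 0 < j%:R :> R by rewrite ltr0n (leq_trans i0).
    by rewrite lef_pV2 ?posrE ?exprn_gt0// lerXn2r ?nnegrE ?ler_nat// ltW.
  under eq_bigr do rewrite -powRN2.
  by apply: (le_trans (@sum_powR_neg R 1 K ltr01)); rewrite invr1.
pose x : R := d%:R / m%:R; have x0 : 0 < x by rewrite divr_gt0.
have Sx : S <= C * (4 * x).
  (* On d j > m one has j x >= 1, hence 1 + j x <= 2 j x and j^(-2) <= w(j). Unlike j^(-2) cut off
     at m/d, this majorant is decreasing, as [HC] requires. *)
  pose w j : R := 4 * (x ^+ 2 / (1 + j%:R * x) ^+ 2).
  have y0 j : 0 < 1 + j%:R * x by rewrite ltr_pwDl// mulr_ge0// ltW.
  have w0 j : 0 <= w j by rewrite mulr_ge0// divr_ge0 ?sqr_ge0.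
  apply: (@le_trans _ _ (\sum_(1 <= j < M) h j ^+ 4 * w j)).
    rewrite /S big_mkcond [leLHS]big_nat [leRHS]big_nat /=.
    apply: ler_sum => j /andP[j0 _]; case: ifP => [mdj|_]; last by rewrite mulr_ge0 ?exprn_ge0.
    rewrite ler_wpM2l ?exprn_ge0//.
    have jR : 0 < j%:R :> R by rewrite ltr0n.
    have jx : 1 <= j%:R * x.
      by rewrite /x mulrA ler_pdivlMr// mul1r -natrM ler_nat mulnC ltnW.
    rewrite /w mulrA ler_pdivlMr ?exprn_gt0// mulrC ler_pdivrMr ?exprn_gt0//.
    rewrite (_ : 4 * x ^+ 2 * j%:R ^+ 2 = (2 * (j%:R * x)) ^+ 2); last by ring.
    by rewrite lerXn2r ?nnegrE ?mulr_ge0 ?(ltW (y0 _)) ?(ltW x0)//; lra.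
  apply: HC => [//|i j /andP[i0 ij]|K]; last first.
    by rewrite -mulr_sumr ler_wpM2l// sum_inv_sqr_shift.
  rewrite ler_wpM2l// ler_wpM2l ?sqr_ge0// lef_pV2 ?posrE ?exprn_gt0//.
  by rewrite lerXn2r ?nnegrE ?(ltW (y0 _))// lerD2l ler_wpM2r ?ler_nat// ltW.
rewrite normrM ger0_norm// ler_pdivlMr ?ltr0n ?addn_gt0 ?d0//.
apply: (@le_trans _ _ (d%:R * ((h d / d%:R) ^+ 2 * S) * (d + m)%N%:R)).
  by rewrite ler_wpM2r// ler_wpM2l.
have -> : d%:R * ((h d / d%:R) ^+ 2 * S) * (d + m)%N%:R
  = h d ^+ 2 * (S + S / x).
  by rewrite /x natrD; field; rewrite !gt_eqF.
rewrite mulrC ler_wpM2r ?sqr_ge0//.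
have : S / x <= C * 4 by rewrite ler_pdivrMr// -mulrA.
by lra.
Qed.

(** In the error of [second_moment_error], the sum over multiples of e is O(h(e)^2 m^(-s)/e) by
    [tail_coef_bound], h being [sqf_ratio]. Squared and weighted by e^s, it leaves m^(-2s) times the
    sum of h(e)^4 e^(s-2), which is bounded because s < 1. *)
Lemma truncated_moment s : 0 < s -> s < 1 -> exists2 C : R, 0 < C &
  forall N m M, 0 < N -> (0 < m)%N ->
  `|\sum_(1 <= k < (Num.truncn N).+1) (N - k%:R) ^+ 2 * tail_sum R m M k ^+ 2
    - N ^+ 3 / 3 * tail_mean R m M|
  <= C * (N ^+ 2 * N `^ s * (m%:R `^ (- s)) ^+ 2).
Proof.
move=> s0 s1; have [C C0 HC] := sum_sqf_ratio_weight R.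
have [C1 C10 HC1] := tail_coef_bound.
pose A : R := 2 / (1 - s) + s^-1.
have A0 : 0 < A by rewrite addr_gt0 ?invr_gt0// divr_gt0// subr_gt0.
pose A2 : R := 1 + (1 - s)^-1.
have A20 : 0 < A2 by rewrite addr_gt0// invr_gt0 subr_gt0.
exists ((C1 * (C * A)) ^+ 2 * (C * A2)).
  by rewrite !mulr_gt0// exprn_gt0// !mulr_gt0.
move=> N m M N0 m0; have mR : 0 < m%:R :> R by rewrite ltr0n.
rewrite -tail_coef_form; apply: (le_trans (@second_moment_error R N s _ M N0 (ltW s0) (ltW s1))).
rewrite [leRHS]mulrCA ler_wpM2l//; first by rewrite mulr_ge0 ?powR_ge0 ?exprn_ge0// ltW.
set h := sqf_ratio R; have h0 n : 0 <= h n by exact: sqf_ratio_ge0.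
pose w n : R := n%:R `^ (- s) / (n + m)%N%:R.
have w0 n : 0 <= w n by rewrite divr_ge0 ?powR_ge0.
have wdecr i j : (0 < i <= j)%N -> w j <= w i.
  move=> /andP[i0 ij]; apply: ler_pM; rewrite ?powR_ge0 ?invr_ge0//.
    by apply: powR_decr; rewrite ?i0// oppr_le0 ltW.
  by rewrite lef_pV2 ?posrE ?ltr0n ?addn_gt0 ?m0 ?orbT// ler_nat leq_add2r.
pose B : R := A * m%:R `^ (- s).
have wB K : \sum_(1 <= n < K) w n <= B by exact: sum_powR_shift.
have inner e : (0 < e)%N ->
   \sum_(1 <= d < M | (e %| d)%N) `|d%:R * tail_coef R m M d| * d%:R `^ (- s)
   <= C1 * h e ^+ 2 * (C * (B / e%:R)).
  move=> e0; rewrite sum_multiples//.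
  apply: (@le_trans _ _ (\sum_(1 <= j < M) C1 * h e ^+ 2 * (h j ^+ 4 * w (e * j)%N))).
    rewrite big_mkcond [leLHS]big_nat [leRHS]big_nat /=; apply: ler_sum => j /andP[j0 _].
    have T0 : 0 <= C1 * h e ^+ 2 * (h j ^+ 4 * w (e * j)%N).
      by rewrite !mulr_ge0 ?exprn_ge0// ltW.
    case: ifP => // _.
    have ej0 : (0 < e * j)%N by rewrite muln_gt0 e0.
    apply: (@le_trans _ _ (C1 * h (e * j)%N ^+ 2 / (e * j + m)%N%:R * (e * j)%N%:R `^ (- s))).
      by rewrite ler_wpM2r ?powR_ge0// HC1.
    have -> : C1 * h (e * j)%N ^+ 2 / (e * j + m)%N%:R * (e * j)%N%:R `^ (- s)
      = C1 * h (e * j)%N ^+ 2 * w (e * j)%N by rewrite /w; ring.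
    have -> : C1 * h e ^+ 2 * (h j ^+ 4 * w (e * j)%N)
      = C1 * (h e ^+ 2 * h j ^+ 4) * w (e * j)%N by ring.
    rewrite ler_wpM2r// ler_pM2l//.
    apply: (@le_trans _ _ (h e ^+ 2 * h j ^+ 2)).
      by rewrite -exprMn lerXn2r ?nnegrE ?mulr_ge0// sqf_ratioM.
    by rewrite ler_wpM2l ?sqr_ge0// sqf_ratio_exp2_le4.
  rewrite -mulr_sumr ler_wpM2l//; first by rewrite mulr_ge0 ?sqr_ge0// ltW.
  apply: HC => [n _|i j /andP[i0 ij]|K]; first exact: w0.
    by apply: wdecr; rewrite muln_gt0 e0 i0 leq_pmul2l.
  exact: sum_weight_multiples.
apply: (@le_trans _ _ (\sum_(1 <= e < M)
   (C1 * (C * B)) ^+ 2 * (h e ^+ 4 * e%:R `^ (- (1 + (1 - s)))))).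
  rewrite [leLHS]big_nat [leRHS]big_nat; apply: ler_sum => e /andP[e0 _].
  have eR : 0 < e%:R :> R by rewrite ltr0n.
  apply: (@le_trans _ _ (e%:R `^ s * (C1 * h e ^+ 2 * (C * (B / e%:R))) ^+ 2)).
    rewrite ler_wpM2l ?powR_ge0// lerXn2r ?nnegrE ?inner//.
      by rewrite sumr_ge0// => d _; rewrite mulr_ge0 ?powR_ge0.
    by rewrite !mulr_ge0 ?sqr_ge0 ?invr_ge0 ?powR_ge0// ltW.
  have -> : - (1 + (1 - s)) = - (1 + 1) + s by ring.
  rewrite gt0_powRD// powRN2 le_eqVlt; apply/orP; left; apply/eqP.
  by field; rewrite gt_eqF.
rewrite -mulr_sumr.
have -> : (C1 * (C * A)) ^+ 2 * (C * A2) * (m%:R `^ (- s)) ^+ 2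
  = (C1 * (C * B)) ^+ 2 * (C * A2) by rewrite /B; ring.
rewrite ler_wpM2l ?sqr_ge0//.
apply: HC => [n _|i j ij|K]; first exact: powR_ge0.
  by apply: powR_decr => //; rewrite oppr_le0 addr_ge0// subr_ge0 ltW.
by apply: sum_powR_neg; rewrite subr_gt0.
Qed.

(* A non-squarefree q <= n is a multiple of some b^2 with b >= 2, and
   1/2^2 + 1/3^2 + ... <= 3/4. *)
Lemma squarefree_count n :
  n%:R / 4 <= \sum_(1 <= q < n.+1) (squarefree q)%:R :> R.
Proof.
have H : n%:R <= \sum_(1 <= q < n.+1) (squarefree q)%:R
    + \sum_(2 <= b < n.+1) \sum_(1 <= q < n.+1 | (b ^ 2 %| q)%N) 1 :> R.
  rewrite (exchange_big_dep xpredT)//= -big_split /=.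
  have -> : n%:R = \sum_(1 <= q < n.+1) 1 :> R by rewrite sumr_const_nat subn1.
  rewrite [leLHS]big_nat [leRHS]big_nat; apply: ler_sum => q /andP[q0 qn].
  case sq : (squarefree q); first by rewrite lerDl sumr_ge0.
  have [p pp pq] : exists2 p, prime p & (p ^ 2 %| q)%N.
    apply/not_exists2P => Hp; move/squarefreeP: sq; apply; split => // p pp.
    by apply/negP => pq; have [] := Hp p.
  rewrite add0r big_mkcond (bigD1_seq p) ?iota_uniq//=; last first.
    rewrite mem_index_iota prime_gt1//=; apply: leq_ltn_trans qn.
    by apply: leq_trans (dvdn_leq q0 pq); rewrite expnS expn1 leq_pmulr// prime_gt0.
  by rewrite pq lerDl sumr_ge0// => b _; case: ifP.
have H2 : \sum_(2 <= b < n.+1) \sum_(1 <= q < n.+1 | (b ^ 2 %| q)%N) 1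
    <= n%:R * (3 / 4) :> R.
  apply: (@le_trans _ _ (\sum_(2 <= b < n.+1) n%:R * b%:R `^ (- (1 + 1)))).
    rewrite [leLHS]big_nat [leRHS]big_nat; apply: ler_sum => b /andP[b2 _].
    have b0 : (0 < b ^ 2)%N by rewrite expn_gt0 (ltn_trans _ b2).
    rewrite powRN2 sum_multiples// -natrX.
    pose w q : R := (q <= n)%N%:R.
    have : \sum_(1 <= j < n.+1) w (b ^ 2 * j)%N <= n%:R / (b ^ 2)%:R.
      apply: sum_weight_multiples => // [i j /andP[_ ij]|K].
        rewrite /w; case: (leqP j n) => // jn; by rewrite (leq_trans ij jn).
      have [Kn|nK] := leqP K n.+1.
        apply: (@le_trans _ _ (\sum_(1 <= q < K) 1)).
          by apply: ler_sum => q _; rewrite /w; case: leq.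
        by rewrite sumr_const_nat ler_nat; lia.
      rewrite (@big_cat_nat _ _ _ n.+1)//= 1?ltnW// [X in _ + X]big_nat.
      rewrite [X in _ + X]big1 ?addr0 => [|q /andP[nq _]]; last by rewrite /w leqNgt nq.
      apply: (@le_trans _ _ (\sum_(1 <= q < n.+1) 1)).
        by apply: ler_sum => q _; rewrite /w; case: leq.
      by rewrite sumr_const_nat subn1.
    apply: le_trans; rewrite big_mkcond /=; apply: ler_sum => j _.
    by rewrite /w ltnS; case: leq.
  rewrite -mulr_sumr ler_wpM2l//.
  have [n1|n1] := leqP n 1; first by rewrite big_geq//; lra.
  (* The term b = 2 gives 1/4, and the tail from b = 3 on is at most 1/2. *)
  rewrite big_ltn// powRN2.
  have := @sum_powR_tail R 1 2 n.+1 ltr01 isT.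
  rewrite divr1 powR_inv1// => T; lra.
lra.
Qed.

(** At least 8m/4 - m = m squarefree q lie in (m, 8m], each with phi(q) <= 8m; and m/(8m)^3 = 1/(512
    m^2). *)
Lemma tail_mean_ge m M : (0 < m)%N -> (8 * m < M)%N ->
  (512 * m%:R ^+ 2)^-1 <= tail_mean R m M.
Proof.
move=> m0 mM; have mR : 0 < m%:R :> R by rewrite ltr0n.
rewrite /tail_mean (@big_cat_nat _ _ _ (8 * m).+1)//=; last by lia.
apply: (@le_trans _ _ (\sum_(m.+1 <= q < (8 * m).+1) (squarefree q)%:R / (8 * m)%:R ^+ 3)).
  rewrite -mulr_suml ler_pdivlMr ?exprn_gt0 ?ltr0n ?muln_gt0//.
  have := squarefree_count (8 * m).
  rewrite (@big_cat_nat _ _ _ m.+1)//=; last by lia.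
  have : \sum_(1 <= q < m.+1) (squarefree q)%:R <= m%:R :> R.
    apply: (@le_trans _ _ (\sum_(1 <= q < m.+1) 1)).
      by apply: ler_sum => q _; case: squarefree.
    by rewrite sumr_const_nat subn1.
  have -> : (512 * m%:R ^+ 2)^-1 * (8 * m)%:R ^+ 3 = m%:R :> R.
    by rewrite natrM; field; rewrite gt_eqF.
  rewrite natrM; lra.
rewrite -[leLHS]addr0; apply: lerD; last first.
  by rewrite sumr_ge0// => q _; rewrite divr_ge0// exprn_ge0.
rewrite [leLHS]big_nat [leRHS]big_nat; apply: ler_sum => q /andP[mq qm].
have q0 : (0 < q)%N by apply: leq_trans mq.
rewrite ler_wpM2l// lef_pV2 ?posrE ?exprn_gt0 ?ltr0n ?totient_gt0 ?muln_gt0//.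
rewrite lerXn2r ?nnegrE// ler_nat; apply: (leq_trans (leq_totient q)).
by rewrite -ltnS.
Qed.

End Bounds.

(** * Passage to the limit *)

Section Limits.
Local Open Scope classical_set_scope.
Variable R : realType.
Implicit Types (N y s : R) (d e k n m M : nat).

Lemma sum_totient_sqr : exists2 C : R, 0 < C &
  forall M, \sum_(0 <= q < M) (squarefree q)%:R / (totient q)%:R ^+ 2 <= C.
Proof.
have [C C0 HC] := sum_sqf_ratio_weight R; exists (C * 2); first by rewrite mulr_gt0.
move=> M; case: M => [|M]; first by rewrite big_geq// mulr_ge0// ltW.
(* The term q = 0 vanishes, as 0 is not squarefree. *)
rewrite big_ltn// mul0r add0r.
apply: (@le_trans _ _ (\sum_(1 <= j < M.+1) sqf_ratio R j ^+ 4 * j%:R `^ (- (1 + 1)))).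
  rewrite [leLHS]big_nat [leRHS]big_nat; apply: ler_sum => q /andP[q0 _].
  rewrite sqf_totient_sqr// expr_div_n -powRN2.
  by rewrite ler_wpM2r ?powR_ge0// sqf_ratio_exp2_le4.
apply: HC => [n _|i j ij|K]; [exact: powR_ge0| |].
  by apply: powR_decr; rewrite ?oppr_le0.
by apply: (le_trans (@sum_powR_neg R 1 K ltr01)); rewrite invr1.
Qed.

Lemma cvg_tail_mean m : cvgn (tail_mean R m).
Proof.
have [C _ HC] := sum_totient_sqr.
apply: nondecreasing_is_cvgn => [n M nM|].
  have [Mm|mM] := leqP n m.+1.
    by rewrite [leLHS]big_geq// sumr_ge0// => q _; rewrite divr_ge0// exprn_ge0.
  rewrite [leRHS](@big_cat_nat _ _ _ n) ?(ltnW mM)//= lerDl.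
  by rewrite sumr_ge0// => q _; rewrite divr_ge0// exprn_ge0.
exists C => _ [M _ <-]; apply: le_trans (HC M).
have [Mm|mM] := leqP M m.+1.
  by rewrite [leLHS]big_geq// sumr_ge0// => q _; rewrite divr_ge0// exprn_ge0.
rewrite [leRHS](@big_cat_nat _ _ _ m.+1) ?(ltnW mM)//=.
rewrite -[leLHS]add0r; apply: lerD.
  by rewrite sumr_ge0// => q _; rewrite divr_ge0// exprn_ge0.
rewrite [leLHS]big_nat [leRHS]big_nat; apply: ler_sum => q /andP[mq _].
have t0 : (0 < totient q)%N by rewrite totient_gt0; apply: leq_trans mq.
rewrite ler_wpM2l// lef_pV2 ?posrE ?exprn_gt0 ?ltr0n//.
by rewrite ler_weXn2l// ler1n.
Qed.

(** The divisors of gcd(q, k) are at most k, so the inner range can be made independent of the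
    truncation. The terms are then at most (1 + ... + k)/phi(q)^2, and [sum_totient_sqr] gives
    absolute convergence. *)
Lemma cvg_tail_sum m k : (0 < k)%N -> cvgn (tail_sum R m ^~ k).
Proof.
move=> k0.
pose u q : R := (squarefree q)%:R / (totient q)%:R ^+ 2 *
  \sum_(1 <= d < k.+1 | (d %| gcdn q k)%N) (mobius (q %/ d)%N)%:~R * d%:R.
have -> : tail_sum R m ^~ k = fun n => \sum_(m.+1 <= q < n) u q.
  apply/funext => n; rewrite tail_sumE [LHS]big_nat [RHS]big_nat.
  apply: eq_bigr => q /andP[mq qn]; rewrite /u; congr (_ * _).
  have q0 : (0 < q)%N by apply: leq_trans mq.
  have g0 : (0 < gcdn q k)%N by rewrite gcdn_gt0 q0.
  under eq_bigl do rewrite -dvdn_gcd.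
  rewrite (@sum_divisors_range _ (gcdn q k) n) ?g0; last first.
    by rewrite (leq_ltn_trans _ qn)// dvdn_leq ?dvdn_gcdl.
  rewrite [RHS](@sum_divisors_range _ (gcdn q k) k.+1) ?g0//.
  by rewrite ltnS dvdn_leq ?dvdn_gcdr.
rewrite (is_cvg_series_restrict m.+1 u); apply: normed_cvg.
have [C _ HC] := sum_totient_sqr.
apply: nondecreasing_is_cvgn => [a b ab|].
  by rewrite /= -subr_ge0 sub_series_geq// sumr_ge0// => q _; rewrite divr_ge0// exprn_ge0.
pose B : R := \sum_(1 <= d < k.+1) d%:R.
have B0 : 0 <= B by rewrite sumr_ge0// => q _; rewrite divr_ge0// exprn_ge0.
exists (C * B) => _ [M _ <-]; apply: (@le_trans _ _
  (\sum_(0 <= q < M) (squarefree q)%:R / (totient q)%:R ^+ 2 * B)); last first.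
  by rewrite -mulr_suml ler_wpM2r.
rewrite /series /=; apply: ler_sum => q _; rewrite /u normrM ger0_norm ?divr_ge0 ?exprn_ge0//.
rewrite ler_wpM2l ?divr_ge0 ?exprn_ge0//; apply: (le_trans (ler_norm_sum _ _ _)).
rewrite /B big_mkcond /=; apply: ler_sum => d _; case: ifP => // _.
by rewrite normrM [`|d%:R|]ger0_norm// ler_piMl// normr_mobius_le1.
Qed.

Lemma complex_cvg (u : nat -> R) (l : R) :
  u n @[n --> \oo] --> l ->
  ((u n)%:C : (R[i] : numFieldType)) @[n --> \oo] --> (l%:C : (R[i] : numFieldType)).
Proof.
move=> /cvgrPdist_lt ul; apply/cvgrPdist_lt => e e0.
(* A positive element of [R[i]] is real, so the radius descends to [R]. *)
have eE : e = (complex.Re e)%:C :> R[i] by rewrite RRe_real// gtr0_real.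
move: e0; rewrite eE => e0; have e0R : 0 < complex.Re e by rewrite -ltcR.
near=> n; rewrite -rmorphB normc_def /= expr0n addr0 sqrtr_sqr ltcR.
near: n; exact: ul.
Unshelve. all: by end_near. Qed.

Lemma lt_truncn_nat y q : 1 <= y -> (y < q%:R) = (Num.truncn y < q)%N.
Proof. by move=> y1; rewrite !ltNge ltnNge truncn_ge_nat// (le_trans ler01). Qed.

Lemma sum_gt_truncn (V : nmodType) y n (F : nat -> V) : 1 <= y ->
  \sum_(1 <= q < n | y < q%:R) F q = \sum_((Num.truncn y).+1 <= q < n) F q.
Proof.
move=> y1; under eq_bigl do rewrite lt_truncn_nat//.
by rewrite [RHS](big_nat_widenl _ 1%N).
Qed.

Lemma singular_tailE y k : 1 <= y -> (0 < k)%N ->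
  singular_tail y k = (limn (tail_sum R (Num.truncn y) ^~ k))%:C.
Proof.
move=> y1 k0; apply: (cvg_lim (@norm_hausdorff (R[i] : numFieldType) (R[i] : numFieldType)^o)).
have -> : (fun n => \sum_(1 <= q < n | y < q%:R) ((mobius q)%:~R ^+ 2 /
     (totient q)%:R ^+ 2 * ramanujan_sum R q (- k%:Z) : R[i]))
   = fun n => (tail_sum R (Num.truncn y) n k)%:C.
  apply/funext => n; rewrite sum_gt_truncn// tail_sumE raddf_sum [LHS]big_nat [RHS]big_nat.
  apply: eq_bigr => q /andP[mq qn].
  rewrite -rmorphXn mobius_sqr /=; case sq : (squarefree q); last first.
    by rewrite !mul0r.
  rewrite (ramanujan_sumE _ _ _ _ sq qn) rmorphM fmorph_div rmorphXn /=.
  by rewrite !rmorph_nat.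
exact/complex_cvg/cvg_tail_sum.
Qed.

Lemma singular_tail_meanE y : 1 <= y ->
  singular_tail_mean y = limn (tail_mean R (Num.truncn y)).
Proof.
move=> y1; rewrite /singular_tail_mean /pos_series.
congr (limn _); apply/funext => n; rewrite sum_gt_truncn//.
by apply: eq_bigr => q _; rewrite -rmorphXn mobius_sqr rmorph_nat.
Qed.

(** The sum over k is finite and the constant of [truncated_moment] is uniform in M, so the bound
    survives the limit. *)
Lemma limit_moment s : 0 < s -> s < 1 -> exists2 C : R, 0 < C &
  forall N m, 0 < N -> (0 < m)%N ->
  `|\sum_(1 <= k < (Num.truncn N).+1) (N - k%:R) ^+ 2 * limn (tail_sum R m ^~ k) ^+ 2
    - N ^+ 3 / 3 * limn (tail_mean R m)|
  <= C * (N ^+ 2 * N `^ s * (m%:R `^ (- s)) ^+ 2).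
Proof.
move=> s0 s1; have [C C0 HC] := truncated_moment R s s0 s1; exists C => // N m N0 m0.
set K := (Num.truncn N).+1.
pose u M := \sum_(1 <= k < K) (N - k%:R) ^+ 2 * tail_sum R m M k ^+ 2
    - N ^+ 3 / 3 * tail_mean R m M.
set l := _ - _.
have ul : u M @[M --> \oo] --> l.
  apply: cvgB; last by apply: cvgMr; exact: cvg_tail_mean.
  rewrite /l big_nat_cond; under eq_fun do rewrite big_nat_cond.
  apply: (@cvg_big R nat +%R 0) => [|k /andP[/andP[k0 _] _]]; first exact: add_continuous.
  apply: cvgMr; rewrite expr2; under eq_fun do rewrite expr2.
  by apply: cvgM; exact: cvg_tail_sum.
have nul : `|u M| @[M --> \oo] --> `|l| by exact: cvg_norm.
rewrite -(cvg_lim (@Rhausdorff R) nul); apply: limr_le; first by apply/cvg_ex; exists `|l|.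
by apply: nearW => M; exact: HC.
Qed.

Lemma lim_tail_mean_ge m : (0 < m)%N ->
  (512 * m%:R ^+ 2)^-1 <= limn (tail_mean R m).
Proof.
move=> m0; apply: limr_ge; first exact: cvg_tail_mean.
by near=> M; apply: tail_mean_ge => //; near: M; exact: nbhs_infty_gt.
Unshelve. all: by end_near. Qed.

End Limits.

(** * From the absolute error bound to the relative error (y^2/N)^delta *)

Theorem theorem1 (R : realType) (delta : R)
    (delta_gt0 : 0 < delta) (delta_lt1 : delta < 1) :
  exists C : R, 0 < C /\
    forall N y : R, 1 <= y -> y <= Num.sqrt N ->
    exists E : R,
      `|E| <= C * (y ^+ 2 / N) `^ delta /\
      \sum_(1 <= k < (Num.truncn N).+1)
        ((N - k%:R) ^+ 2)%:C * singular_tail y k ^+ 2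
      = (singular_tail_mean y * (N ^+ 3 / 3) * (1 + E))%:C.
Proof.
have s0 : 0 < 1 - delta by rewrite subr_gt0.
have s1 : 1 - delta < 1 by lra.
have [C C0 HC] := limit_moment R (1 - delta) s0 s1.
(* The 3 undoes the division in N^3/3, and 512 comes from T(y) >= 1/(512 m^2). *)
exists ((3 * 512) * C); split; first by rewrite !mulr_gt0// ltr0n.
move=> N y y1 yN.
(* [Num.sqrt] is 0 at nonpositive arguments, so 1 <= y <= sqrt N forces N > 0. *)
have N0 : 0 < N by rewrite -sqrtr_gt0; lra.
set m := Num.truncn y.
have m0 : (0 < m)%N by rewrite /m truncn_gt_nat.
have mR : 0 < m%:R :> R by rewrite ltr0n.
have my : m%:R <= y by have /andP[] := truncn_itv (le_trans ler01 y1).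
have T_ge := lim_tail_mean_ge R m m0; rewrite singular_tail_meanE// -/m.
set T := limn _ in T_ge *.
have T0 : 0 < T by apply: lt_le_trans T_ge; rewrite invr_gt0 mulr_gt0 ?ltr0n ?exprn_gt0.
have {HC} := HC N m N0 m0; rewrite -/T.
set L := \sum_(1 <= k < _) _ => HL.
have D0 : 0 < T * (N ^+ 3 / 3) by rewrite mulr_gt0// divr_gt0// exprn_gt0.
(* E is the relative error by definition, which makes the equation an identity; only its size needs
   the moment bound. *)
exists ((L - N ^+ 3 / 3 * T) / (T * (N ^+ 3 / 3))); split; last first.
  have -> : T * (N ^+ 3 / 3) * (1 + (L - N ^+ 3 / 3 * T) / (T * (N ^+ 3 / 3))) = L.
    by field; rewrite !gt_eqF.
  rewrite /L raddf_sum [LHS]big_nat [RHS]big_nat; apply: eq_bigr => k /andP[k0 _].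
  by rewrite singular_tailE// -rmorphXn -rmorphM.
rewrite normrM normfV (gtr0_norm D0) ler_pdivrMr//; apply: (le_trans HL).
have m_y : (m%:R ^+ 2 / N) `^ delta <= (y ^+ 2 / N) `^ delta.
  apply: ge0_ler_powR; rewrite ?nnegrE ?divr_ge0 ?sqr_ge0// ?(ltW N0) ?(ltW delta_gt0)//.
  by rewrite ler_pM2r ?invr_gt0// lerXn2r ?nnegrE//; lra.
set P := (m%:R ^+ 2 / N) `^ delta in m_y; have P0 : 0 <= P by exact: powR_ge0.
(* With s = 1 - delta, N^(2+s) m^(-2s) = N^3 m^(-2) (m^2/N)^delta, and m^(-2) is then traded for 512
   T(y). *)
have -> : N ^+ 2 * N `^ (1 - delta) * (m%:R `^ (- (1 - delta))) ^+ 2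
   = N ^+ 3 * m%:R ^- 2 * P.
  rewrite /P powRM ?sqr_ge0 ?invr_ge0 ?(ltW N0)// gt0_powRD// powRr1 ?(ltW N0)//.
  rewrite (_ : - (1 - delta) = -1 + delta); last by ring.
  rewrite gt0_powRD// powR_inv1// -[N^-1](powR_inv1 (ltW N0)) -powRrM mulN1r.
  by rewrite (expr2 m%:R) powRM// !expr2 invfM; ring.
have step : C * (N ^+ 3 * m%:R ^- 2 * P) <= (3 * 512) * C * P * (T * (N ^+ 3 / 3)).
  have -> : (3 * 512) * C * P * (T * (N ^+ 3 / 3)) = (C * P * N ^+ 3) * (512 * T) by field.
  have -> : C * (N ^+ 3 * m%:R ^- 2 * P) = (C * P * N ^+ 3) * m%:R ^- 2 by ring.
  apply: ler_wpM2l; first by rewrite !mulr_ge0 ?exprn_ge0// ltW.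
  by move: T_ge; rewrite invfM ler_pdivrMl ?ltr0n.
apply: (le_trans step); rewrite (ler_pM2r D0); apply: ler_wpM2l m_y.
by rewrite !mulr_ge0 ?ler0n// ltW.
Qed.
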